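(* The category of boolean inverse monoids (with morphisms of boolean inverse monoids) is dually equivalent to the category of boolean groupoids (with continuous covering functors); that is, the opposite of the first category is equivalent to the second.
   Context: Inverse monoids. Let $S$ be an inverse monoid with zero, and let $E(S)$ be its set of idempotents. The natural partial order on $S$ is: $s\le t$ iff $s=te$ for some $e\in E(S)$. All meets and joins are with respect to this order. Elements $s,t$ are orthogonal if $s^{-1}t=0=st^{-1}$. $S$ is a boolean inverse monoid if: (BM1) $(E(S),\le)$ is a boolean algebra; (BM2) $(S,\le)$ is a meet semilattice; (BM3) every pair of orthogonal elements has a join. Filters. A filter in $S$ is a nonempty subset $F\subseteq S$ that is upwardly closed ($a\in F$, $a\le s$ imply $s\in F$) and such that for all $x,y\in F$ there is $z\in F$ with $z\le x,y$. It is proper if $0\notin F$. An ultrafilter is a proper filter that is maximal among proper filters. A morphism $\theta:S\to T$ of boolean inverse monoids is a semigroup homomorphism such that: (M1) $\theta|_{E(S)}:E(S)\to E(T)$ is a homomorphism of boolean algebras; (M2) $\theta:(S,\le)\to(T,\le)$ is a homomorphism of meet semilattices; (M3) the inverse image under $\theta$ of every ultrafilter in $T$ is an ultrafilter in $S$. Groupoids. A groupoid $G$ is a small category in which every arrow is invertible; $G_0$ is its set of identities, $\mathbf d(g)=g^{-1}g$, $\mathbf r(g)=gg^{-1}$, and $gh$ is defined iff $\mathbf d(g)=\mathbf r(h)$. A bisection is a subset $A\subseteq G$ such that for $a,b\in A$, $\mathbf d(a)=\mathbf d(b)$ implies $a=b$, and $\mathbf r(a)=\mathbf r(b)$ implies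 $a=b$. A topological groupoid (inversion and multiplication continuous) is étale if its domain map $\mathbf d: G\to G_0$ is a local homeomorphism. $G$ is a boolean groupoid if: (BG1) $G$ is a Hausdorff étale topological groupoid; (BG2) $G_0$ is compact; (BG3) $G$ has a basis of compact open bisections. A covering functor $\alpha:G\to H$ is a functor such that for each $e\in G_0$ it restricts to a bijection $\{g\in G:\mathbf d(g)=e\}\to\{h\in H:\mathbf d(h)=\alpha(e)\}$. A morphism of boolean groupoids is a continuous covering functor. *)

(* Defs.v *)
From mathcomp Require Import all_boot.
From mathcomp Require Import boolp classical_sets functions.
From mathcomp Require Import topology.

Set Implicit Arguments.
Unset Strict Implicit.
Unset Printing Implicit Defensive.

Local Open Scope classical_set_scope.

(* Morphisms are compared with Leibniz equality; the concrete categories below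
   rely on functional extensionality and proof irrelevance for their laws. *)
Record category := Category {
  obj :> Type;
  hom : obj -> obj -> Type;
  idm : forall a, hom a a;
  compm : forall a b c, hom b c -> hom a b -> hom a c;
  compmA : forall a b c d (h : hom c d) (g : hom b c) (f : hom a b),
    compm h (compm g f) = compm (compm h g) f;
  compid_m : forall a b (f : hom a b), compm (idm b) f = f;
  compm_id : forall a b (f : hom a b), compm f (idm a) = f
}.

Definition opposite (C : category) : category :=
  @Category C (fun a b => hom b a) (@idm C) (fun a b c g f => compm f g)
    (fun a b c d h g f => esym (compmA f g h))
    (fun a b f => compm_id f) (fun a b f => compid_m f).

Record functor (C D : category) := Functor {
  fobj :> C -> D;
  fmap : forall a b, hom a b -> hom (fobj a) (fobj b);
  fmap_id : forall a, fmap (idm a) = idm (fobj a);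
  fmap_comp : forall a b c (g : hom b c) (f : hom a b),
    fmap (compm g f) = compm (fmap g) (fmap f)
}.

Definition functor_id (C : category) : functor C C :=
  @Functor C C id (fun a b f => f) (fun a => erefl) (fun a b c g f => erefl).

Definition functor_comp (C D E : category) (G : functor D E)
    (F : functor C D) : functor C E :=
  @Functor C E (fun a => G (F a)) (fun a b f => fmap G (fmap F f))
    (fun a => etrans (congr1 (@fmap _ _ G _ _) (fmap_id F a)) (fmap_id G (F a)))
    (fun a b c g f => etrans (congr1 (@fmap _ _ G _ _) (fmap_comp F g f))
                             (fmap_comp G (fmap F g) (fmap F f))).

Definition is_isomorphism (C : category) (a b : C) (f : hom a b) : Prop :=
  exists g : hom b a, compm g f = idm a /\ compm f g = idm b.

Definition naturally_isomorphic (C D : category) (F G : functor C D) : Prop :=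
  exists eta : forall a : C, hom (F a) (G a),
    (forall a b (f : hom a b),
       compm (eta b) (fmap F f) = compm (fmap G f) (eta a)) /\
    (forall a, is_isomorphism (eta a)).

Definition equivalent_categories (C D : category) : Prop :=
  exists (F : functor C D) (G : functor D C),
    naturally_isomorphic (functor_comp G F) (functor_id C) /\
    naturally_isomorphic (functor_comp F G) (functor_id D).

(* Order-theoretic notions for a subset [D] of a type [T] ordered by
   [le : T -> T -> Prop]; the order need not be decidable. *)
Section Posets.
Context {T : Type} (D : set T) (le : T -> T -> Prop).

Definition partial_order : Prop :=
  [/\ forall x, D x -> le x x,
      forall x y, D x -> D y -> le x y -> le y x -> x = y &
      forall x y z, D x -> D y -> D z -> le x y -> le y z -> le x z].

Definition is_meet (x y m : T) : Prop :=
  [/\ D m, le m x, le m y & forall z, D z -> le z x -> le z y -> le z m].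

Definition is_join (x y j : T) : Prop :=
  [/\ D j, le x j, le y j & forall z, D z -> le x z -> le y z -> le j z].

Definition is_bottom (b : T) : Prop := D b /\ forall x, D x -> le b x.

Definition is_top (t : T) : Prop := D t /\ forall x, D x -> le x t.

Definition is_complement (x y : T) : Prop :=
  exists b t, [/\ is_bottom b, is_top t, is_meet x y b & is_join x y t].

Definition meet_semilattice : Prop :=
  partial_order /\ forall x y, D x -> D y -> exists m, is_meet x y m.

Definition lattice : Prop :=
  meet_semilattice /\ forall x y, D x -> D y -> exists j, is_join x y j.

Definition distributive : Prop :=
  forall x y z yz xy xz m, D x -> D y -> D z ->
    is_join y z yz -> is_meet x y xy -> is_meet x z xz ->
    is_meet x yz m -> is_join xy xz m.

(* The one-element boolean algebra (bottom = top) is allowed. *)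
Definition boolean_algebra : Prop :=
  [/\ lattice, exists b, is_bottom b, exists t, is_top t, distributive &
      forall x, D x -> exists2 y, D y & is_complement x y].

End Posets.

Section PosetMorphisms.
Context {T U : Type} (D : set T) (leT : T -> T -> Prop)
  (E : set U) (leU : U -> U -> Prop) (f : T -> U).

Definition meet_morphism : Prop :=
  (forall x, D x -> E (f x)) /\
  (forall x y m, D x -> D y -> is_meet D leT x y m ->
     is_meet E leU (f x) (f y) (f m)).

Definition boolean_algebra_morphism : Prop :=
  [/\ meet_morphism,
      forall x y j, D x -> D y -> is_join D leT x y j ->
        is_join E leU (f x) (f y) (f j),
      forall b, is_bottom D leT b -> is_bottom E leU (f b),
      forall t, is_top D leT t -> is_top E leU (f t) &
      forall x y, D x -> D y -> is_complement D leT x y ->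
        is_complement E leU (f x) (f y)].

End PosetMorphisms.

Local Open Scope group_scope.

(* The inverse operation and the zero are uniquely determined by the monoid, so
   carrying them as data changes neither the objects nor the morphisms.
   The trivial case 0 = 1 is allowed. *)
Record inverseMonoid0 := InverseMonoid0 {
  im_sort :> monoidType;
  im_inv : im_sort -> im_sort;
  im_zero : im_sort;
  im_invP : forall s t : im_sort,
    (s * t * s = s /\ t * s * t = t) <-> t = im_inv s;
  im_mul0 : forall s : im_sort, im_zero * s = im_zero;
  im_mulr0 : forall s : im_sort, s * im_zero = im_zero
}.

Section InverseMonoids.
Variable S : inverseMonoid0.
Implicit Types (s t e : S) (F : set S).

Definition idempotents : set S := [set e | e * e = e].

Definition nat_le s t : Prop := exists2 e, idempotents e & s = t * e.

Definition orthogonal s t : Prop :=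
  im_inv s * t = im_zero S /\ s * im_inv t = im_zero S.

Definition is_boolean : Prop :=
  [/\ boolean_algebra idempotents nat_le,
      meet_semilattice setT nat_le &
      forall s t, orthogonal s t -> exists j, is_join setT nat_le s t j].

Definition is_filter F : Prop :=
  [/\ F !=set0,
      forall a s, F a -> nat_le a s -> F s &
      forall x y, F x -> F y -> exists z, [/\ F z, nat_le z x & nat_le z y]].

Definition is_proper_filter F : Prop := is_filter F /\ ~ F (im_zero S).

Definition is_ultrafilter F : Prop :=
  is_proper_filter F /\
  forall F', is_proper_filter F' -> F `<=` F' -> F' = F.

End InverseMonoids.
Arguments idempotents S : clear implicits.

Record booleanInverseMonoid := BooleanInverseMonoid {
  bim_sort :> inverseMonoid0;
  bimP : is_boolean bim_sort
}.

Record is_bim_morphism (S T : booleanInverseMonoid) (f : S -> T) : Prop :=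
  IsBimMorphism {
    bim_mul : {morph f : x y / x * y};
    bim_boolean : boolean_algebra_morphism
      (idempotents S) (@nat_le S) (idempotents T) (@nat_le T) f;
    bim_meet : meet_morphism setT (@nat_le S) setT (@nat_le T) f;
    bim_ultra : forall F : set T, is_ultrafilter F -> is_ultrafilter (f @^-1` F)
  }.

Record bim_hom (S T : booleanInverseMonoid) := BimHom {
  bim_fun :> S -> T;
  bim_homP : is_bim_morphism bim_fun
}.

(* A groupoid is given by its set of arrows, an identity being identified with
   the object it stands for.  [gmul g h] is meaningful only when
   [gdom g = gcod h]: its other values are arbitrary, and neither the axioms
   nor the morphisms ever refer to them. *)
Record groupoid_on (G : Type) := GroupoidOn {
  gdom : G -> G;
  gcod : G -> G;
  ginv : G -> G;
  gmul : G -> G -> G;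
  gdom_dom : forall g, gdom (gdom g) = gdom g;
  gcod_dom : forall g, gcod (gdom g) = gdom g;
  gdom_cod : forall g, gdom (gcod g) = gcod g;
  gcod_cod : forall g, gcod (gcod g) = gcod g;
  gdom_mul : forall g h, gdom g = gcod h -> gdom (gmul g h) = gdom h;
  gcod_mul : forall g h, gdom g = gcod h -> gcod (gmul g h) = gcod g;
  gmulA : forall f g h, gdom f = gcod g -> gdom g = gcod h ->
    gmul f (gmul g h) = gmul (gmul f g) h;
  gmul_dom : forall g, gmul g (gdom g) = g;
  gmul_cod : forall g, gmul (gcod g) g = g;
  gdom_inv : forall g, gdom (ginv g) = gcod g;
  gcod_inv : forall g, gcod (ginv g) = gdom g;
  gmulVg : forall g, gmul (ginv g) g = gdom g;
  gmulgV : forall g, gmul g (ginv g) = gcod g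
}.

Record topGroupoid := TopGroupoid {
  tg_sort :> topologicalType;
  tg_groupoid : groupoid_on tg_sort;
  tg_inv_continuous : continuous (ginv tg_groupoid);
  tg_mul_continuous :
    {within [set p : tg_sort * tg_sort |
               gdom tg_groupoid p.1 = gcod tg_groupoid p.2],
      continuous (fun p => gmul tg_groupoid p.1 p.2)}
}.

Section LocalHomeomorphisms.
Context {X Y : topologicalType}.

Definition homeomorphism_between (A : set X) (B : set Y) (f : X -> Y) : Prop :=
  [/\ set_bij A B f, {within A, continuous f} &
      exists2 g : Y -> X, {within B, continuous g} & {in A, cancel f g}].

Definition local_homeomorphism (f : X -> Y) : Prop :=
  forall x, exists (U : set X) (V : set Y),
    [/\ open U, U x, open V & homeomorphism_between U V f].

End LocalHomeomorphisms.

Section TopGroupoids.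
Variable G : topGroupoid.

Definition dom : G -> G := gdom (tg_groupoid G).
Definition cod : G -> G := gcod (tg_groupoid G).
Definition mul : G -> G -> G := gmul (tg_groupoid G).

Definition identities : set G := [set e | dom e = e].

(* The domain map corestricted to the space of identities, which carries the
   topology induced by that of [G]. *)
Definition dom_identities (g : G) : set_type identities :=
  exist _ (dom g) (mem_set (gdom_dom (tg_groupoid G) g : identities (dom g))).

Definition is_etale : Prop := local_homeomorphism dom_identities.

Definition is_bisection (A : set G) : Prop :=
  forall a b, A a -> A b ->
    (dom a = dom b -> a = b) /\ (cod a = cod b -> a = b).

Definition is_boolean_groupoid : Prop :=
  [/\ hausdorff_space G, is_etale, compact identities &
      exists2 B : set (set G), basis B &
        forall A, B A -> [/\ compact A, open A & is_bisection A]].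

End TopGroupoids.
Arguments identities G : clear implicits.

Record booleanGroupoid := BooleanGroupoid {
  bg_sort :> topGroupoid;
  bgP : is_boolean_groupoid bg_sort
}.

Record is_covering_functor (G H : topGroupoid) (f : G -> H) : Prop :=
  IsCoveringFunctor {
    cf_dom : {morph f : g / dom g};
    cf_cod : {morph f : g / cod g};
    cf_mul : forall g h, dom g = cod h -> f (mul g h) = mul (f g) (f h);
    cf_star : forall e, identities G e ->
      set_bij [set g | dom g = e] [set h | dom h = f e] f
  }.

Record bg_hom (G H : booleanGroupoid) := BgHom {
  bg_fun :> G -> H;
  bg_covering : is_covering_functor bg_fun;
  bg_continuous : continuous bg_fun
}.

Section BimCategory.
Implicit Types S T U V : booleanInverseMonoid.

Lemma bim_hom_eq S T (f g : bim_hom S T) : f =1 g -> f = g.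
Proof.
case: f g => [f fP] [g gP] /= /funext fg.
by subst g; congr BimHom; exact: Prop_irrelevance.
Qed.

Lemma bim_id_subproof S : is_bim_morphism (@id S).
Proof. by split => //; split. Qed.

Lemma bim_comp_subproof S T U (g : bim_hom T U) (f : bim_hom S T) :
  is_bim_morphism (g \o f).
Proof.
case: g f => [g [gM [[gE gI] gJ g0 g1 gC] [_ gW] gU]]
  [f [fM [[fE fI] fJ f0 f1 fC] [_ fW] fU]] /=; split => /=.
- by move=> x y /=; rewrite fM gM.
- split; first split.
  + by move=> x /fE /gE.
  + by move=> x y m Dx Dy /fI fm; apply: gI; [exact: fE|exact: fE|exact: fm].
  + by move=> x y m Dx Dy /fJ fm; apply: gJ; [exact: fE|exact: fE|exact: fm].
  + by move=> b /f0 /g0.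
  + by move=> b /f1 /g1.
  + by move=> x y Dx Dy /fC fm; apply: gC; [exact: fE|exact: fE|exact: fm].
- by split => // x y m _ _ /fW fm; apply: gW => //; exact: fm.
- by move=> F /gU /fU.
Qed.

Definition bim_id S : bim_hom S S := BimHom (bim_id_subproof S).

Definition bim_comp S T U (g : bim_hom T U) (f : bim_hom S T) : bim_hom S U :=
  BimHom (bim_comp_subproof g f).

Lemma bim_compA S T U V (h : bim_hom U V) (g : bim_hom T U)
    (f : bim_hom S T) :
  bim_comp h (bim_comp g f) = bim_comp (bim_comp h g) f.
Proof. exact: bim_hom_eq. Qed.

Lemma bim_comp_id_l S T (f : bim_hom S T) : bim_comp (bim_id T) f = f.
Proof. exact: bim_hom_eq. Qed.

Lemma bim_comp_id_r S T (f : bim_hom S T) : bim_comp f (bim_id S) = f.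
Proof. exact: bim_hom_eq. Qed.

Definition BIM : category :=
  @Category booleanInverseMonoid bim_hom bim_id bim_comp
    bim_compA bim_comp_id_l bim_comp_id_r.

End BimCategory.

Section BgCategory.
Implicit Types G H K L : booleanGroupoid.

Lemma bg_hom_eq G H (f g : bg_hom G H) : f =1 g -> f = g.
Proof.
case: f g => [f fP fC] [g gP gC] /= /funext fg.
by subst g; congr BgHom; exact: Prop_irrelevance.
Qed.

Lemma bg_id_subproof G : is_covering_functor (@id G).
Proof. by split => // e _; split => // g; exists g. Qed.

Lemma bg_comp_subproof G H K (g : bg_hom H K) (f : bg_hom G H) :
  is_covering_functor (g \o f).
Proof.
case: g f => [g [gd gc gM gS] _] [f [fd fc fM fS] _] /=; split.
- by move=> x /=; rewrite fd gd.
- by move=> x /=; rewrite fc gc.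
- by move=> x y xy /=; rewrite fM // gM // -fd -fc xy.
- move=> e Ge; have He : identities H (f e) by rewrite /identities /= -fd Ge.
  have [f1 f2 f3] := fS e Ge; have [g1 g2 g3] := gS _ He; split.
  + by move=> x /f1 /g1.
  + move=> x y /[!inE] xe ye /g2 fxy.
    by apply: f2; rewrite ?inE //; apply: fxy; rewrite inE; exact: f1.
  + by move=> z /g3[y /f3[x xe <-] <-]; exists x.
Qed.

Definition bg_id G : bg_hom G G :=
  BgHom (bg_id_subproof G) (fun x => cvg_id).

Definition bg_comp G H K (g : bg_hom H K) (f : bg_hom G H) : bg_hom G K :=
  BgHom (bg_comp_subproof g f)
    (fun x => continuous_comp (@bg_continuous _ _ f x) (@bg_continuous _ _ g (f x))).

Lemma bg_compA G H K L (h : bg_hom K L) (g : bg_hom H K)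
    (f : bg_hom G H) :
  bg_comp h (bg_comp g f) = bg_comp (bg_comp h g) f.
Proof. exact: bg_hom_eq. Qed.

Lemma bg_comp_id_l G H (f : bg_hom G H) : bg_comp (bg_id H) f = f.
Proof. exact: bg_hom_eq. Qed.

Lemma bg_comp_id_r G H (f : bg_hom G H) : bg_comp f (bg_id G) = f.
Proof. exact: bg_hom_eq. Qed.

Definition BG : category :=
  @Category booleanGroupoid bg_hom bg_id bg_comp
    bg_compA bg_comp_id_l bg_comp_id_r.

End BgCategory.

(* Main.v *)
From HB Require Import structures.
From mathcomp Require Import all_boot.
From mathcomp Require Import boolp classical_sets functions.
From mathcomp Require Import topology.
Require Import Defs.

(** A boolean inverse monoid S is sent to the groupoid of its ultrafilters, with
    d(F) generated by the s^-1 s for s in F and with FG generated by the products,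
    topologized by the sets V_s of the ultrafilters containing s; a boolean
    groupoid G is sent to the inverse monoid of its compact open bisections.
    Morphisms act by inverse images in both directions.  An ultrafilter is
    determined by d(F) and any one of its elements, which makes V_s a bisection
    and inverse images star-bijective.  The V_s are exactly the compact open
    bisections: by compactness such a bisection is a finite union of V_s, and
    the union can be made orthogonal, hence is V_j for the join j.  Conversely
    an ultrafilter of compact open bisections has, by compactness, a common
    point g, and then consists of all the bisections through g. *)

Set Implicit Arguments.
Unset Strict Implicit.
Unset Printing Implicit Defensive.

Local Open Scope classical_set_scope.
Local Open Scope group_scope.

Local Notation "s ^-1" := (im_inv s) : group_scope.
Local Notation "s <= t" := (nat_le s t) : group_scope.
Local Notation "0" := (im_zero _) : group_scope.

(** * Inverse monoids *)

(** The shaping obstacle is that only idempotents have complements. A general element [s] is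
    therefore cut into [s * e] and [s * e'], with [e] an idempotent and [e'] its complement, and
    boolean reasoning is done on domains [s^-1 * s]. Maximality of a filter is awkward to verify
    directly. It is traded for a separation criterion ([ultra_sep], [sep_ultra]): whatever lies
    outside an ultrafilter is disjoint from one of its members. This needs binary meets, and it is
    the algebraic face of the Hausdorff property: it produces disjoint neighbourhoods on one side,
    and on the other it is how the bisections through a point are seen to form an ultrafilter. Two
    conditions on morphisms answer each other. (M3) makes the inverse image of an ultrafilter an
    ultrafilter, in particular nonempty, which star-bijectivity needs. The covering condition
    supplies lifts of arrows, without which an inverse image of a product of bisections need not be
    the product of the inverse images. Inclusions between ultrafilters are equalities, so most
    identities of filters below are proved by one inclusion only. *)

Section InverseMonoidTheory.
Variable S : inverseMonoid0.
Implicit Types s t u x y e f : S.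

Lemma mulgVK s : s * s^-1 * s = s.
Proof. by have [_ /(_ erefl)[]] := im_invP s s^-1. Qed.

Lemma mulVgK s : s^-1 * s * s^-1 = s^-1.
Proof. by have [_ /(_ erefl)[]] := im_invP s s^-1. Qed.

Lemma inv_uniq s t : s * t * s = s -> t * s * t = t -> t = s^-1.
Proof. by move=> h1 h2; apply/im_invP. Qed.

Lemma im_invK s : s^-1^-1 = s.
Proof. by apply/esym/inv_uniq; rewrite ?mulgVK ?mulVgK. Qed.

Lemma idem_inv e : idempotents S e -> e^-1 = e.
Proof. by move=> he; apply/esym/inv_uniq; rewrite !he. Qed.

(** With [x] the inverse of [e * f], the element [f * x * e] is also an inverse of [e * f], so it
    equals [x] by uniqueness. This makes [x] idempotent, hence its own inverse, hence equal to
    [e * f]. *)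
Lemma idem_mul e f : idempotents S e -> idempotents S f -> idempotents S (e * f).
Proof.
move=> he hf; set x := (e * f)^-1.
have h1 : e * f * x * (e * f) = e * f by exact: mulgVK.
have h2 : x * (e * f) * x = x by exact: mulVgK.
have hx : f * x * e = x.
  apply: inv_uniq.
    by rewrite !mulgA -(mulgA e f f) hf -(mulgA _ e e) he -[RHS]h1 !mulgA.
  rewrite !mulgA -(mulgA _ e e) he -(mulgA _ f f) hf.
  by rewrite -[in RHS]h2 !mulgA.
have xx : idempotents S x.
  rewrite /idempotents /= -{1 2}hx !mulgA.
  have -> : f * x * e * f * x * e = f * (x * (e * f) * x) * e by rewrite !mulgA.
  by rewrite h2.
have <- : x = e * f by rewrite -(idem_inv xx) /x im_invK.
exact: xx.
Qed.

(** Both [e * f] (an idempotent) and [f * e] are inverses of [e * f]. *)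
Lemma idem_comm e f : idempotents S e -> idempotents S f -> e * f = f * e.
Proof.
move=> he hf; have hef := idem_mul he hf; have hfe := idem_mul hf he.
rewrite -(idem_inv hef); apply/esym/inv_uniq.
  rewrite !mulgA -(mulgA e f f) hf -(mulgA _ e e) he.
  by rewrite -(mulgA (e * f)); exact: hef.
rewrite !mulgA -(mulgA f e e) he -(mulgA _ f f) hf.
by rewrite -(mulgA (f * e)); exact: hfe.
Qed.

Lemma idemVg s : idempotents S (s^-1 * s).
Proof. by rewrite /idempotents /= mulgA mulVgK. Qed.

Lemma idemgV s : idempotents S (s * s^-1).
Proof. by rewrite /idempotents /= mulgA mulgVK. Qed.

Lemma idem1 : idempotents S 1.
Proof. by rewrite /idempotents /= mulg1. Qed.

Lemma idem0 : idempotents S 0.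
Proof. by rewrite /idempotents /= im_mul0. Qed.

Lemma im_invM s t : (s * t)^-1 = t^-1 * s^-1.
Proof.
apply/esym/inv_uniq.
  have -> : s * t * (t^-1 * s^-1) * (s * t) = s * ((t * t^-1) * (s^-1 * s)) * t
    by rewrite !mulgA.
  rewrite (idem_comm (idemgV t) (idemVg s)) !mulgA mulgVK -!mulgA.
  by rewrite (mulgA t) mulgVK.
have -> : t^-1 * s^-1 * (s * t) * (t^-1 * s^-1) =
    t^-1 * ((s^-1 * s) * (t * t^-1)) * s^-1 by rewrite !mulgA.
rewrite (idem_comm (idemVg s) (idemgV t)) !mulgA mulVgK -!mulgA.
by rewrite (mulgA s^-1) mulVgK.
Qed.

Lemma idem_conj s e : idempotents S e -> idempotents S (s * e * s^-1).
Proof.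
move=> he; rewrite /idempotents /=.
have -> : s * e * s^-1 * (s * e * s^-1) = s * (e * (s^-1 * s) * e) * s^-1
  by rewrite !mulgA.
rewrite (idem_comm he (idemVg s)) -(mulgA _ e e) he !mulgA.
by rewrite mulgVK.
Qed.

Lemma idem_swap s e : idempotents S e -> s * e = s * e * s^-1 * s.
Proof.
move=> he; rewrite -(mulgA _ s^-1) -(mulgA s e) (idem_comm he (idemVg s)).
by rewrite !mulgA mulgVK.
Qed.

Lemma idem_conjV s e : idempotents S e -> idempotents S (s^-1 * e * s).
Proof. by move=> he; have := idem_conj s^-1 he; rewrite im_invK. Qed.

Lemma idem_swapV s e : idempotents S e -> e * s = s * (s^-1 * e * s).
Proof.
by move=> he; rewrite !mulgA (idem_comm (idemgV s) he) -!mulgA (mulgA s) mulgVK.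
Qed.

(** The witness of the order can always be the domain of the smaller element, since [s = t * e]
    gives [s^-1 * s = t^-1 * t * e]. Later proofs use this to rewrite an inequality as an
    equation. *)
Lemma leE s t : s <= t <-> s = t * (s^-1 * s).
Proof.
split=> [[e he ->]|->]; last by exists (s^-1 * s) => //; exact: idemVg.
have -> : (t * e)^-1 * (t * e) = t^-1 * t * e.
  rewrite im_invM (idem_inv he) mulgA -(mulgA e) (idem_comm he (idemVg t)).
  by rewrite -mulgA he.
by rewrite !mulgA mulgVK.
Qed.

Lemma le_idemr t e : idempotents S e -> t * e <= t.
Proof. by exists e. Qed.

Lemma le_ideml t e : idempotents S e -> e * t <= t.
Proof.
by move=> he; exists (t^-1 * e * t); [exact: idem_conjV|exact: idem_swapV].
Qed.

(** The left-handed form of the order; monotonicity of right multiplication rests on it. *)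
Lemma leEl s t : s <= t <-> s = s * s^-1 * t.
Proof.
split=> [[e he ->]|->]; last exact: le_ideml (idemgV s).
by rewrite im_invM (idem_inv he) mulgA -(mulgA t e e) he -idem_swap.
Qed.

Lemma le_refl s : s <= s.
Proof. by exists 1; [exact: idem1|rewrite mulg1]. Qed.

Lemma le_trans s t u : s <= t -> t <= u -> s <= u.
Proof.
move=> [e he ->] [f hf ->]; exists (f * e); first exact: idem_mul.
by rewrite mulgA.
Qed.

Lemma le_inv s t : s <= t -> s^-1 <= t^-1.
Proof.
by move=> [e he ->]; rewrite im_invM (idem_inv he); exact: le_ideml.
Qed.

Lemma le_mull s t u : s <= t -> u * s <= u * t.
Proof. by move=> [e he ->]; exists e => //; rewrite mulgA. Qed.

Lemma le_mulr s t u : s <= t -> s * u <= t * u.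
Proof.
move=> /leEl ->; rewrite -mulgA; exact: le_ideml (idemgV s).
Qed.

Lemma le_mul s t u v : s <= t -> u <= v -> s * u <= t * v.
Proof. by move=> st uv; apply: le_trans (le_mulr _ st) (le_mull _ uv). Qed.

Lemma le_domV s t : s <= t -> s^-1 * s <= t^-1 * t.
Proof. by move=> st; apply: le_mul => //; exact: le_inv. Qed.

Lemma le_anti s t : s <= t -> t <= s -> s = t.
Proof.
move=> [e he st] [f hf ts]; have h : s = s * f * e by rewrite -ts.
by rewrite ts {2}h -!mulgA (idem_comm he hf) (mulgA f) hf mulgA -h.
Qed.

Lemma le0 s : 0 <= s.
Proof. by exists 0; [exact: idem0|rewrite im_mulr0]. Qed.

Lemma le_idem1 e : idempotents S e -> e <= 1.
Proof. by move=> he; exists e => //; rewrite mul1g. Qed.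

Lemma idem_le e s : idempotents S e -> s <= e -> idempotents S s.
Proof. by move=> he [f hf ->]; exact: idem_mul. Qed.

Lemma idem_leE e f : idempotents S e -> idempotents S f -> e <= f <-> e = f * e.
Proof.
by move=> he hf; split=> [/leE|->]; rewrite ?idem_inv ?he //; exists e.
Qed.

Lemma dom_mul_idem s e : idempotents S e -> e <= s^-1 * s ->
  (s * e)^-1 * (s * e) = e.
Proof.
move=> he /(idem_leE he (idemVg s)) es.
by rewrite im_invM (idem_inv he) -mulgA (mulgA s^-1) -es he.
Qed.

Lemma dom_le_idem s t e : idempotents S e -> s <= t * e -> s^-1 * s <= e.
Proof.
move=> he /le_domV st; apply: le_trans st _.
rewrite im_invM (idem_inv he) mulgA -(mulgA e) -{3}he.
by apply: le_mulr; apply: le_idemr; exact: idemVg.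
Qed.

Lemma inv0 : (0 : S)^-1 = 0.
Proof. exact: idem_inv idem0. Qed.

Lemma dom_eq0 s : s^-1 * s = 0 -> s = 0.
Proof. by move=> h; rewrite -(mulgVK s) -mulgA h im_mulr0. Qed.

Lemma le0_eq s : s <= 0 -> s = 0.
Proof. by move=> [e _ ->]; rewrite im_mul0. Qed.

Lemma le_partial_order (D : set S) : partial_order D (@nat_le S).
Proof.
split=> [x _|x y _ _|x y z _ _ _]; [exact: le_refl|exact: le_anti|exact: le_trans].
Qed.

Lemma idem_meet e f : idempotents S e -> idempotents S f ->
  is_meet (idempotents S) (@nat_le S) e f (e * f).
Proof.
move=> he hf; split; [exact: idem_mul|exact: le_idemr|exact: le_ideml|].
move=> z hz /(idem_leE hz he) ze /(idem_leE hz hf) zf.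
by apply/(idem_leE hz (idem_mul he hf)); rewrite -mulgA -zf.
Qed.

Lemma is_meet_uniq (D : set S) x y m n :
  is_meet D (@nat_le S) x y m -> is_meet D (@nat_le S) x y n -> m = n.
Proof.
by move=> [Dm mx my gm] [Dn nx ny gn]; apply: le_anti; [exact: gn|exact: gm].
Qed.

Lemma is_join_uniq (D : set S) x y m n :
  is_join D (@nat_le S) x y m -> is_join D (@nat_le S) x y n -> m = n.
Proof.
by move=> [Dm mx my gm] [Dn nx ny gn]; apply: le_anti; [exact: gm|exact: gn].
Qed.

End InverseMonoidTheory.

(** * Filters and their groupoid operations *)

Section Filters.
Variable S : inverseMonoid0.
Implicit Types (s t u x y e f p : S) (F G H P : set S).

(** Only products [s^-1 * s] of an element with itself are taken; as filters are down-directed, this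
    agrees with the product of [finv F] and [F] ([fmulVg]). *)
Definition fdom F : set S := [set x | exists2 s, F s & s^-1 * s <= x].

Definition finv F : set S := [set x | F x^-1].

Definition fmul F G : set S :=
  [set x | exists s t, [/\ F s, G t & s * t <= x]].

(** The coset of [P] through [s]: the device that rebuilds a filter from its domain and one of its
    elements. *)
Definition translate s P : set S := [set x | exists2 p, P p & s * p <= x].

Lemma filter_up F s t : is_filter F -> F s -> s <= t -> F t.
Proof. by move=> [_ + _]; exact. Qed.

Lemma filter_lb F s t : is_filter F -> F s -> F t ->
  exists z, [/\ F z, z <= s & z <= t].
Proof. by move=> [_ _]; apply. Qed.

Lemma filter_idem_mul F e f : is_filter F -> idempotents S e ->
  idempotents S f -> F e -> F f -> F (e * f).
Proof.
move=> fF he hf Fe Ff; have [z [Fz ze zf]] := filter_lb fF Fe Ff.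
apply: (filter_up fF Fz); rewrite -(idem_le he ze); exact: le_mul.
Qed.

Lemma mem_fdom F s : F s -> fdom F (s^-1 * s).
Proof. by exists s => //; exact: le_refl. Qed.

Lemma fdom_sub F G : F `<=` G -> fdom F `<=` fdom G.
Proof. by move=> FG x [s Fs sx]; exists s => //; exact: FG. Qed.

Lemma filter_mul_fdom F s p : is_filter F -> F s -> fdom F p -> F (s * p).
Proof.
move=> fF Fs [t Ft tp]; have [z [Fz zs zt]] := filter_lb fF Fs Ft.
apply: (filter_up fF Fz); have /leE -> := zs.
by apply: le_mull; apply: le_trans tp; exact: le_domV.
Qed.

Lemma filter_translate F s : is_filter F -> F s -> translate s (fdom F) = F.
Proof.
move=> fF Fs; apply/seteqP; split=> [x [p Fp spx]|x Fx].
  by apply: filter_up spx => //; exact: filter_mul_fdom.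
have [z [Fz zs zx]] := filter_lb fF Fs Fx.
exists (z^-1 * z); first exact: mem_fdom.
by have /leE <- := zs.
Qed.

Lemma fdom_filter F : is_filter F -> is_filter (fdom F).
Proof.
move=> fF; have [[s Fs] _ _] := fF; split.
- by exists (s^-1 * s); exact: mem_fdom.
- by move=> x y [t Ft tx] xy; exists t => //; exact: le_trans xy.
- move=> x y [t Ft tx] [u Fu uy]; have [z [Fz zt zu]] := filter_lb fF Ft Fu.
  exists (z^-1 * z); split; first exact: mem_fdom.
    by apply: le_trans tx; exact: le_domV.
  by apply: le_trans uy; exact: le_domV.
Qed.

Lemma fdom_proper F : is_proper_filter F -> is_proper_filter (fdom F).
Proof.
move=> [fF F0]; split; first exact: fdom_filter.
by move=> [s Fs] /le0_eq /dom_eq0 s0; apply: F0; rewrite -s0.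
Qed.

Lemma translate_filter s P : is_filter P -> is_filter (translate s P).
Proof.
move=> fP; have [[p Pp] _ _] := fP; split.
- by exists (s * p), p => //; exact: le_refl.
- by move=> x y [q Pq qx] xy; exists q => //; exact: le_trans xy.
- move=> x y [q Pq qx] [r Pr ry]; have [z [Pz zq zr]] := filter_lb fP Pq Pr.
  exists (s * z); split; first by exists z => //; exact: le_refl.
    by apply: le_trans qx; exact: le_mull.
  by apply: le_trans ry; exact: le_mull.
Qed.

(** The condition on [s^-1 * s] prevents collapse: if [s * p = 0], an [r] of [P] below both [p] and
    [s^-1 * s] satisfies [r = s^-1 * (s * r) = 0]. *)
Lemma translate_proper s P : is_proper_filter P -> P (s^-1 * s) ->
  is_proper_filter (translate s P).
Proof.
move=> [fP P0] Ps; split; first exact: translate_filter.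
move=> [p Pp /le0_eq sp0]; have [r [Pr rp rs]] := filter_lb fP Pp Ps.
have ir := idem_le (idemVg s) rs.
have sr0 : s * r = 0 by apply: le0_eq; rewrite -sp0; exact: le_mull.
apply: P0; suff <- : r = 0 by [].
by have /(idem_leE ir (idemVg s)) -> := rs; rewrite -mulgA sr0 im_mulr0.
Qed.

Lemma fdom_translate s P : is_filter P -> fdom P = P -> P (s^-1 * s) ->
  fdom (translate s P) = P.
Proof.
move=> fP dP Ps; apply/seteqP; split=> [x [y [p Pp py] yx]|x Px].
  have [q [Pq qp qs]] := filter_lb fP Pp Ps.
  have iq := idem_le (idemVg s) qs.
  apply: (filter_up fP Pq); apply: le_trans yx.
  rewrite -(dom_mul_idem iq qs); apply: le_domV; apply: le_trans py.
  exact: le_mull.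
have [q [Pq qx qs]] := filter_lb fP Px Ps.
have iq := idem_le (idemVg s) qs.
by exists (s * q); [exists q => //; exact: le_refl|rewrite dom_mul_idem].
Qed.

Lemma ultra_filter F : is_ultrafilter F -> is_filter F.
Proof. by move=> [[]]. Qed.

Lemma ultra_neq0 F : is_ultrafilter F -> ~ F 0.
Proof. by move=> [[]]. Qed.

Lemma ultra_sub_eq F G : is_ultrafilter F -> is_ultrafilter G -> F `<=` G ->
  F = G.
Proof. by move=> [_ uF] [pG _] FG; exact/esym/uF. Qed.

(** A proper [F'] above [F] has the same domain, by maximality of [fdom F], and shares an element
    [s] with [F]; both are the translate of that domain by [s]. *)
Lemma fdom_ultra_ultra F : is_proper_filter F -> is_ultrafilter (fdom F) ->
  is_ultrafilter F.
Proof.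
move=> pF [_ uD]; split=> // F' pF' FF'.
have [[s Fs] _ _] := pF.1.
have dF' : fdom F' = fdom F by apply: uD; [exact: fdom_proper|exact: fdom_sub].
rewrite -(filter_translate pF.1 Fs) -dF'.
by rewrite (filter_translate pF'.1) //; exact: FF'.
Qed.

(** A proper [P] above [fdom F] yields the proper filter [translate s P] above [F], which must be
    [F]; the domains of the elements [s * q] then bring [P] back inside [fdom F]. *)
Lemma fdom_ultra F : is_ultrafilter F -> is_ultrafilter (fdom F).
Proof.
move=> uF; have [pF mF] := uF; have [[s Fs] _ _] := pF.1.
split; first exact: fdom_proper.
move=> P pP sP; apply/seteqP; split=> // p Pp.
have Ps : P (s^-1 * s) by apply: sP; exact: mem_fdom.
have eF : translate s P = F.
  apply: mF; first exact: translate_proper.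
  rewrite -{1}(filter_translate pF.1 Fs) => x [q Fq qx]; exists q => //.
  exact: sP.
have [q [Pq qp qs]] := filter_lb pP.1 Pp Ps.
have iq := idem_le (idemVg s) qs.
exists (s * q); last by rewrite dom_mul_idem.
by rewrite -eF; exists q => //; exact: le_refl.
Qed.

Lemma fdom_fdom F : fdom (fdom F) = fdom F.
Proof.
apply/seteqP; split=> x [s].
  move=> [t Ft ts] sx; exists t => //; apply: le_trans sx.
  by have := le_domV ts; rewrite (idem_inv (idemVg t)) idemVg.
move=> Fs sx; exists (s^-1 * s); first exact: mem_fdom.
by rewrite (idem_inv (idemVg s)) idemVg.
Qed.

Lemma translate_ultra s P : is_ultrafilter P -> fdom P = P -> P (s^-1 * s) ->
  is_ultrafilter (translate s P).
Proof.
move=> uP dP Ps; apply: fdom_ultra_ultra.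
  by apply: translate_proper => //; case: uP.
by rewrite fdom_translate //; exact: ultra_filter.
Qed.

Lemma mem_translate s P : is_filter P -> P (s^-1 * s) -> translate s P s.
Proof.
by move=> fP Ps; exists (s^-1 * s) => //; rewrite mulgA mulgVK; exact: le_refl.
Qed.

Lemma finvK F : finv (finv F) = F.
Proof. by apply/funext => x; rewrite /finv /= im_invK. Qed.

Lemma finv_sub F G : F `<=` G -> finv F `<=` finv G.
Proof. by move=> FG x; exact: FG. Qed.

Lemma finv_filter F : is_filter F -> is_filter (finv F).
Proof.
move=> fF; have [[s Fs] _ _] := fF; split.
- by exists s^-1; rewrite /finv /= im_invK.
- by move=> x y Fx xy; apply: (filter_up fF Fx); exact: le_inv.
- move=> x y Fx Fy; have [z [Fz zx zy]] := filter_lb fF Fx Fy.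
  exists z^-1; rewrite /finv /= im_invK; split => //.
    by rewrite -(im_invK x); exact: le_inv.
  by rewrite -(im_invK y); exact: le_inv.
Qed.

Lemma finv_proper F : is_proper_filter F -> is_proper_filter (finv F).
Proof.
by move=> [fF F0]; split; [exact: finv_filter|rewrite /finv /= inv0].
Qed.

Lemma finv_ultra F : is_ultrafilter F -> is_ultrafilter (finv F).
Proof.
move=> [pF uF]; split; first exact: finv_proper.
move=> G pG FG; rewrite -(finvK G); congr finv.
apply: uF; first exact: finv_proper.
by rewrite -{1}(finvK F); exact: finv_sub.
Qed.

Lemma finv_fdom F : finv (fdom F) = fdom F.
Proof.
have h : fdom F `<=` finv (fdom F).
  move=> x [s Fs sx]; exists s => //.
  by rewrite -(idem_inv (idemVg s)); exact: le_inv.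
by apply/seteqP; split => //; move/finv_sub: h; rewrite finvK.
Qed.

Lemma fmul_fdomr F : is_filter F -> fmul F (fdom F) = F.
Proof.
move=> fF; apply/seteqP; split=> [x [s [p [Fs Fp spx]]]|x Fx].
  by apply: filter_up spx => //; exact: filter_mul_fdom.
exists x, (x^-1 * x); split => //; first exact: mem_fdom.
by rewrite mulgA mulgVK; exact: le_refl.
Qed.

Lemma finv_fmul F G : finv (fmul F G) = fmul (finv G) (finv F).
Proof.
apply/seteqP; split=> [x [s [t [Fs Gt stx]]]|x [s [t [Gs Ft stx]]]].
  exists t^-1, s^-1; rewrite /finv /= !im_invK; split=> //.
  by rewrite -im_invM -(im_invK x); exact: le_inv.
exists t^-1, s^-1; split => //.
by rewrite -im_invM; exact: le_inv.
Qed.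

Lemma fmul_fdoml F : is_filter F -> fmul (fdom (finv F)) F = F.
Proof.
move=> fF; rewrite -[LHS]finvK finv_fmul finv_fdom fmul_fdomr ?finvK //.
exact: finv_filter.
Qed.

Lemma fmulVg F : is_filter F -> fmul (finv F) F = fdom F.
Proof.
move=> fF; apply/seteqP; split=> [x [s [t [Fs Ft stx]]]|x [s Fs sx]].
  have [z [Fz zs zt]] := filter_lb fF Fs Ft.
  exists z => //; apply: le_trans stx; apply: le_mul => //.
  by rewrite -(im_invK s); exact: le_inv.
by exists s^-1, s; split => //; rewrite /finv /= im_invK.
Qed.

Lemma fmulA F G H : fmul F (fmul G H) = fmul (fmul F G) H.
Proof.
apply/seteqP; split=> x.
  move=> [s [t [Fs [u [v [Gu Hv uvt]]] stx]]].
  exists (s * u), v; split=> //; first by exists s, u; split=> //; exact: le_refl.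
  by rewrite -mulgA; apply: le_trans stx; exact: le_mull.
move=> [s [t [[u [v [Fu Gv uvs]]] Ht stx]]].
exists u, (v * t); split=> //; first by exists v, t; split=> //; exact: le_refl.
by rewrite mulgA; apply: le_trans stx; exact: le_mulr.
Qed.

Lemma fmul_filter F G : is_filter F -> is_filter G -> is_filter (fmul F G).
Proof.
move=> fF fG; have [[s Fs] _ _] := fF; have [[t Gt] _ _] := fG; split.
- by exists (s * t), s, t; split => //; exact: le_refl.
- move=> x y [u [v [Fu Gv uvx]]] xy; exists u, v; split=> //; exact: le_trans xy.
- move=> x y [u [v [Fu Gv uvx]]] [u' [v' [Fu' Gv' uvy]]].
  have [a [Fa au au']] := filter_lb fF Fu Fu'.
  have [b [Gb bv bv']] := filter_lb fG Gv Gv'.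
  exists (a * b); split; first by exists a, b; split=> //; exact: le_refl.
    by apply: le_trans uvx; exact: le_mul.
  by apply: le_trans uvy; exact: le_mul.
Qed.

Lemma fdom_fmul F G : is_filter F -> is_filter G ->
  fdom F = fdom (finv G) -> fdom (fmul F G) = fdom G.
Proof.
move=> fF fG FG; apply/seteqP; split=> x.
  move=> [y [s [t [Fs Gt sty]]] yx].
  have /= := mem_fdom Fs; rewrite FG => -[t' Gt' t's].
  have [z [Gz zt zt']] := filter_lb fG Gt Gt'.
  exists z => //; apply: le_trans yx; apply: le_trans (le_domV sty).
  rewrite im_invM mulgA -(mulgA t^-1).
  have -> : z^-1 * z = z^-1 * (z * z^-1) * z by rewrite mulgA mulVgK.
  apply: le_mul => //; apply: le_mul; first exact: le_inv.
  apply: le_trans t's; rewrite -{1}(im_invK z); apply: le_domV.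
  by rewrite -(im_invK t'); exact: le_inv.
move=> [t Gt tx]; have [[s Fs] _ _] := fF.
exists (s * t); first by exists s, t; split=> //; exact: le_refl.
apply: le_trans tx; rewrite im_invM mulgA -(mulgA t^-1); apply: le_mulr.
by apply: le_idemr; exact: idemVg.
Qed.

(** The domain of the product is that of [G], so only properness is at stake. If [s * t = 0], the
    idempotents [s^-1 * s] and [t * t^-1], which both lie in [fdom F], have product 0. *)
Lemma fmul_ultra F G : is_ultrafilter F -> is_ultrafilter G ->
  fdom F = fdom (finv G) -> is_ultrafilter (fmul F G).
Proof.
move=> uF uG FG; have fF := ultra_filter uF; have fG := ultra_filter uG.
apply: fdom_ultra_ultra; last by rewrite fdom_fmul //; exact: fdom_ultra.
split; first exact: fmul_filter.
move=> [s [t [Fs Gt /le0_eq st0]]].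
have Ds : fdom F (s^-1 * s) := mem_fdom Fs.
have Dt : fdom F (t * t^-1).
  by rewrite FG -{1}(im_invK t); apply: mem_fdom; rewrite /finv /= im_invK.
apply: (ultra_neq0 (fdom_ultra uF)).
have := filter_idem_mul (fdom_filter fF) (idemVg s) (idemgV t) Ds Dt.
by rewrite mulgA -(mulgA s^-1) st0 im_mulr0 im_mul0.
Qed.

Lemma fdom_eq F : is_filter F -> F 1 -> fdom F = F.
Proof.
move=> fF F1; have := filter_translate fF F1.
have <- : fdom F = translate 1 (fdom F); last by [].
apply/seteqP; split=> x; first by exists x; rewrite ?mul1g //; exact: le_refl.
by move=> [p Fp]; rewrite mul1g => /(filter_up (fdom_filter fF)); exact.
Qed.

Lemma fdom1 F : is_filter F -> fdom F 1.
Proof.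
by move=> [[s Fs] _ _]; exists s => //; exact: le_idem1 (idemVg s).
Qed.

Lemma exists_ultra s : s <> 0 -> exists2 F, is_ultrafilter F & F s.
Proof.
move=> s0; pose up := [set x | s <= x].
have fup : is_proper_filter up.
  split; last by move=> /le0_eq.
  split; first by exists s; exact: le_refl.
    by move=> a t; exact: le_trans.
  by move=> x y sx sy; exists s; split=> //; exact: le_refl.
pose Q F := F = set0 \/ (is_proper_filter F /\ F s).
have [C CQ Ctot|F [QF mF]] := @Zorn_bigcup S Q.
- case: (pselect (exists2 F, C F & F !=set0)) => [[F CF [w Fw]]|noC]; last first.
    left; apply/seteqP; split=> // x [F CF Fx]; apply: noC.
    by exists F => //; exists x.
  have Cp G x : C G -> G x -> is_proper_filter G /\ G s.
    by move=> CG Gx; case: (CQ _ CG) => // G0; move: Gx; rewrite G0.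
  have [pF Fs] := Cp _ _ CF Fw.
  right; split; last by exists F.
  split; last by move=> [G CG G0]; have [[_]] := Cp _ _ CG G0.
  split; first by exists s, F.
    move=> a t [G CG Ga] at_; exists G => //.
    by have [[fG _] _] := Cp _ _ CG Ga; exact: filter_up at_.
  move=> x y [G CG Gx] [H CH Hy].
  have [K [CK Kx Ky]] : exists K, [/\ C K, K x & K y].
    by case: (Ctot _ _ CG CH) => [/(_ _ Gx) Hx|/(_ _ Hy) Gy]; [exists H|exists G].
  have [[fK _] _] := Cp _ _ CK Kx.
  have [v [Kv vx vy]] := filter_lb fK Kx Ky.
  by exists v; split=> //; exists K.
- have us : up s by exact: le_refl.
  have pF : is_proper_filter F /\ F s.
    case: QF => // F0; exfalso; apply: (mF up); last by right.
    by rewrite F0; split => // /(_ _ us).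
  exists F; last exact: pF.2.
  split; first exact: pF.1.
  move=> F' pF' FF'; apply: contrapT => ne; apply: (mF F'); last first.
    by right; split => //; apply: FF'; exact: pF.2.
  by split=> // F'F; apply: ne; apply/seteqP.
Qed.

End Filters.

(** * Ultrafilters of a boolean inverse monoid *)

Section BooleanFilters.
Variable S : booleanInverseMonoid.
Implicit Types (s t u x y e f p : S) (F G H P : set S).

Lemma filter_meet F s t m : is_filter F -> is_meet setT (@nat_le S) s t m ->
  F s -> F t -> F m.
Proof.
move=> fF [_ _ _ gm] Fs Ft; have [z [Fz zs zt]] := filter_lb fF Fs Ft.
by apply: (filter_up fF Fz); exact: gm.
Qed.

Lemma has_meet s t : exists m, is_meet setT (@nat_le S) s t m.
Proof. by have [_ [_ hm] _] := bimP S; exact: hm. Qed.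

(** If every meet of [s] with a member of [F] were nonzero, these meets would generate a proper
    filter [F'] containing [F] and [s], so [s] would already be in [F]. *)
Lemma ultra_sep F s : is_ultrafilter F -> ~ F s ->
  exists2 t, F t & forall u, u <= s -> u <= t -> u = 0.
Proof.
move=> [[fF F0] mF] Fs; apply: contrapT => nsep; apply: Fs.
have {}nsep t : F t -> exists u, [/\ u <= s, u <= t & u <> 0].
  move=> Ft; apply: contrapT => h; apply: nsep; exists t => // u us ut.
  by apply: contrapT => u0; apply: h; exists u.
pose F' := [set x | exists t m, [/\ F t, is_meet setT (@nat_le S) s t m & m <= x]].
have [[t0 Ft0] _ _] := fF.
have FF' : F `<=` F'.
  by move=> t Ft; have [m hm] := has_meet s t; exists t, m; split=> //; case: hm.
rewrite -(mF F') //.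
  have [m hm] := has_meet s t0; by exists t0, m; split => //; case: hm.
split; first split.
- by exists t0; exact: FF'.
- by move=> x y [t [m [Ft hm mx]]] xy; exists t, m; split=> //; exact: le_trans xy.
- move=> x y [t [m [Ft [_ ms mt mg] mx]]] [t' [m' [Ft' [_ ms' mt' mg'] my]]].
  have [z [Fz zt zt']] := filter_lb fF Ft Ft'.
  have [n hn] := has_meet s z; have [_ ns nz _] := hn.
  exists n; split; first by exists z, n; split=> //; exact: le_refl.
    by apply: le_trans mx; apply: mg => //; exact: le_trans zt.
  by apply: le_trans my; apply: mg' => //; exact: le_trans zt'.
- move=> [t [m [Ft [_ ms mt mg] /le0_eq m0]]].
  have [u [us ut]] := nsep _ Ft; apply; apply: le0_eq; rewrite -m0.
  exact: mg.
Qed.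

Lemma sep_ultra F : is_proper_filter F ->
  (forall s, ~ F s -> exists2 t, F t & forall u, u <= s -> u <= t -> u = 0) ->
  is_ultrafilter F.
Proof.
move=> pF sep; split=> // G [fG G0] FG; apply/seteqP; split=> // s Gs.
apply: contrapT => /sep[t Ft ut]; apply: G0.
have [z [Gz zs zt]] := filter_lb fG Gs (FG _ Ft).
by rewrite -(ut z).
Qed.

(** Turns the order-theoretic complement into multiplicative facts: the top idempotent is 1 and
    meets of idempotents are products, so distributivity says that [x] is the join of [x * e] and
    [x * e']. *)
Lemma idem_compl e : idempotents S e -> exists e', [/\ idempotents S e',
  e * e' = 0, forall x, idempotents S x -> x * e = 0 -> x <= e' &
  forall x, idempotents S x -> x * e' = 0 -> x <= e].
Proof.
move=> he; have [[_ _ _ dist cp] _ _] := bimP S.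
have [e' he' [b [t [[ib b0] [it t1] mb jt]]]] := cp _ he.
have ee' := idem_meet he he'.
have ee0 : e * e' = 0.
  apply: le0_eq; apply: le_trans (b0 _ (idem0 S)).
  by have [_ _ _] := mb; apply; case: ee'.
have t_1 : t = 1 by apply: le_anti; [exact: le_idem1|exact: t1 (idem1 S)].
subst t; have key x : idempotents S x ->
    is_join (idempotents S) (@nat_le S) (x * e) (x * e') x.
  move=> hx; apply: (dist x e e' 1 _ _ _ hx he he' jt).
  - exact: idem_meet.
  - exact: idem_meet.
  - by have := idem_meet hx (idem1 S); rewrite mulg1.
exists e'; split=> // x hx x0; have [_ _ _] := key x hx; apply=> //.
- by rewrite x0; exact: le0.
- exact: le_ideml.
- exact: le_ideml.
- by rewrite x0; exact: le0.
Qed.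

(** Primeness of ultrafilters, proved in the domain and transported by [s]. If [e] is not in
    [fdom F], some member of [fdom F] is disjoint from it, hence so is some [u^-1 * u] with [u] in
    [F], which then lies below [e']. *)
Lemma ultra_split F s e e' : is_ultrafilter F -> F s -> idempotents S e ->
  idempotents S e' -> (forall x, idempotents S x -> x * e = 0 -> x <= e') ->
  F (s * e) \/ F (s * e').
Proof.
move=> uF Fs he he' hc; have fF := ultra_filter uF.
case: (pselect (fdom F e)) => [De|/(ultra_sep (fdom_ultra uF))[t Dt sep]].
  by left; exact: filter_mul_fdom.
right; apply: filter_mul_fdom => //.
have [u Fu ut] := Dt; apply: (filter_up (fdom_filter fF) (mem_fdom Fu)).
have iu := idemVg u; apply: hc => //.
apply: sep; first exact: le_ideml.
by apply: le_trans ut; exact: le_idemr.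
Qed.

Lemma ultra_neq F G : is_ultrafilter F -> is_ultrafilter G -> F <> G ->
  exists2 s, F s & ~ G s.
Proof.
move=> uF uG FG; apply: contrapT => h; apply: FG; apply: ultra_sub_eq => // s Fs.
by apply: contrapT => Gs; apply: h; exists s.
Qed.

End BooleanFilters.

Record ultrafilter (S : inverseMonoid0) := Ultrafilter {
  uset :> set S;
  usetP : is_ultrafilter uset
}.

HB.instance Definition _ S := gen_eqMixin (ultrafilter S).
HB.instance Definition _ S := gen_choiceMixin (ultrafilter S).

Section UltrafilterGroupoid.
Variable S : booleanInverseMonoid.
Local Notation U := (ultrafilter S).
Implicit Types (s t u x y e f p : S) (F G H : U).

Lemma ueq F G : uset F = uset G -> F = G.
Proof.
by case: F G => [F uF] [G uG] /= FG; subst G; congr Ultrafilter; exact: Prop_irrelevance.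
Qed.

Lemma usub F G : uset F `<=` uset G -> F = G.
Proof. by move=> FG; apply/ueq/ultra_sub_eq => //; exact: usetP. Qed.

Definition udom F := Ultrafilter (fdom_ultra (usetP F)).
Definition uinv F := Ultrafilter (finv_ultra (usetP F)).
Definition ucod F := udom (uinv F).
(* Junk value F when F and G are not composable. *)
Definition umul F G : U :=
  if pselect (fdom F = fdom (finv G)) is left FG
  then Ultrafilter (fmul_ultra (usetP F) (usetP G) FG) else F.

Lemma ufilter F : is_filter F. Proof. exact: ultra_filter (usetP F). Qed.

Lemma umulE F G : udom F = ucod G -> umul F G = fmul F G :> set S.
Proof. by move=> /(congr1 (@uset S)) FG; rewrite /umul; case: pselect. Qed.

Lemma udom_dom F : udom (udom F) = udom F.
Proof. by apply: ueq; exact: fdom_fdom. Qed.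

Lemma uinv_dom F : uinv (udom F) = udom F.
Proof. by apply: ueq; exact: finv_fdom. Qed.

Lemma uinvK F : uinv (uinv F) = F.
Proof. by apply: ueq; exact: finvK. Qed.

Lemma ucod_dom F : ucod (udom F) = udom F.
Proof. by rewrite /ucod uinv_dom udom_dom. Qed.

Lemma udom_cod F : udom (ucod F) = ucod F.
Proof. exact: udom_dom. Qed.

Lemma ucod_cod F : ucod (ucod F) = ucod F.
Proof. exact: ucod_dom. Qed.

Lemma udom_mul F G : udom F = ucod G -> udom (umul F G) = udom G.
Proof.
move=> FG; apply: ueq => /=; rewrite umulE //.
by apply: fdom_fmul; [exact: ufilter|exact: ufilter|move: FG => /(congr1 (@uset S))].
Qed.

Lemma uinv_mul F G : udom F = ucod G -> uinv (umul F G) = umul (uinv G) (uinv F).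
Proof.
move=> FG; apply: ueq => /=; rewrite !umulE ?finv_fmul //.
by rewrite /ucod uinvK.
Qed.

Lemma ucod_mul F G : udom F = ucod G -> ucod (umul F G) = ucod F.
Proof.
by move=> FG; rewrite /ucod uinv_mul // udom_mul // /ucod uinvK.
Qed.

Lemma umulA F G H : udom F = ucod G -> udom G = ucod H ->
  umul F (umul G H) = umul (umul F G) H.
Proof.
move=> FG GH; apply: ueq; rewrite !umulE ?fmulA ?udom_mul ?ucod_mul //.
Qed.

Lemma umul_dom F : umul F (udom F) = F.
Proof. by apply: ueq; rewrite umulE ?ucod_dom // fmul_fdomr //; exact: ufilter. Qed.

Lemma umul_cod F : umul (ucod F) F = F.
Proof. by apply: ueq; rewrite umulE ?udom_cod // fmul_fdoml //; exact: ufilter. Qed.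

Lemma udom_inv F : udom (uinv F) = ucod F. Proof. by []. Qed.

Lemma ucod_inv F : ucod (uinv F) = udom F.
Proof. by rewrite /ucod uinvK. Qed.

Lemma umulVg F : umul (uinv F) F = udom F.
Proof. by apply: ueq; rewrite umulE // fmulVg //; exact: ufilter. Qed.

Lemma umulgV F : umul F (uinv F) = ucod F.
Proof. by rewrite -{1}(uinvK F) umulVg. Qed.

Definition ultrafilter_groupoid : groupoid_on U :=
  GroupoidOn udom_dom ucod_dom udom_cod ucod_cod udom_mul ucod_mul umulA
    umul_dom umul_cod udom_inv ucod_inv umulVg umulgV.

Definition V s : set U := [set F | uset F s].

Definition uopen : set_system U :=
  [set A | forall F, A F -> exists2 s, uset F s & V s `<=` A].

Lemma uopenT : uopen setT.
Proof. by move=> F _; have [[s Fs] _ _] := ufilter F; exists s. Qed.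

(** Binary meets make the sets [V s] a basis and not merely a subbasis. *)
Lemma V_meet s t m : is_meet setT (@nat_le S) s t m -> V m = V s `&` V t.
Proof.
move=> hm; have [_ ms mt _] := hm; apply/seteqP; split=> F /=.
  by move=> Fm; split; apply: filter_up Fm _ => //; exact: ufilter.
by move=> [Fs Ft]; apply: filter_meet hm _ _ => //; exact: ufilter.
Qed.

Lemma uopenI : setI_closed uopen.
Proof.
move=> A B oA oB F [/oA[s Fs sA] /oB[t Ft tB]].
have [m hm] := has_meet s t; have Vm := V_meet hm.
have Fm : V m F by rewrite Vm.
by exists m => //; rewrite Vm; exact: setISS.
Qed.

Lemma uopen_bigU (I : Type) (f : I -> set U) : (forall i, uopen (f i)) ->
  uopen (\bigcup_i f i).
Proof.
move=> of_ F [i _ /of_[s Fs sf]]; exists s => // G /sf fG; by exists i.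
Qed.

HB.instance Definition _ := isOpenTopological.Build U uopenT uopenI uopen_bigU.

Lemma V_open s : open (V s).
Proof. by move=> F Fs; exists s. Qed.

End UltrafilterGroupoid.
Arguments V {S}.

(** * The topology on ultrafilters *)

Section UltrafilterSpace.
Variable S : booleanInverseMonoid.
Local Notation U := (ultrafilter S).
Implicit Types (s t u x y e f : S) (F G H : U).

Lemma uopenP (A : set U) :
  open A <-> forall F, A F -> exists2 s, uset F s & V s `<=` A.
Proof. by []. Qed.

Lemma nbhs_V F s : uset F s -> nbhs F (V s).
Proof. by move=> Fs; apply: open_nbhs_nbhs; split => //; exact: V_open. Qed.

Lemma nbhs_uP F (A : set U) : nbhs F A <-> exists2 s, uset F s & V s `<=` A.
Proof.
rewrite nbhsE; split=> [[B [oB BF] BA]|[s Fs sA]].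
  by have /uopenP/(_ _ BF)[s Fs sB] := oB; exists s => //; apply: subset_trans BA.
by exists (V s) => //; split => //; exact: V_open.
Qed.

Lemma V0 : V (0 : S) = set0.
Proof. by apply/seteqP; split=> // F F0; exact: ultra_neq0 (usetP F) F0. Qed.

Lemma V_sub s t : s <= t -> V s `<=` V t.
Proof. by move=> st F Fs; apply: filter_up Fs st; exact: ufilter. Qed.

Lemma u_continuous (T : topologicalType) (f : T -> U) :
  (forall s, open (f @^-1` V s)) -> continuous f.
Proof.
move=> of_ x A /nbhs_uP[s fs sA]; apply: (filterS (P := f @^-1` V s)).
  by move=> y /sA.
by apply: open_nbhs_nbhs; split.
Qed.

Lemma uinv_continuous : continuous (ginv (ultrafilter_groupoid S)).
Proof.
apply: u_continuous => s; by apply/uopenP => F Fs; exists s^-1.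
Qed.

Lemma umul_continuous :
  {within [set p : U * U | gdom (ultrafilter_groupoid S) p.1 =
                           gcod (ultrafilter_groupoid S) p.2],
    continuous (fun p => gmul (ultrafilter_groupoid S) p.1 p.2)}.
Proof.
apply/subspace_continuousP => -[F G] /= FG A /nbhs_uP[s].
rewrite umulE // => -[a [b [Fa Gb abs]]] sA.
exists (V a, V b) => [|[F' G'] [/= Fa' Gb'] FG'].
  by split; exact: nbhs_V.
by apply: sA; rewrite /V /= umulE //; exists a, b.
Qed.

Definition ultrafilter_tg : topGroupoid := TopGroupoid uinv_continuous umul_continuous.

Lemma u_hausdorff : hausdorff_space U.
Proof.
rewrite open_hausdorff => F G /eqP FG.
have [|s Fs Gs] := ultra_neq (usetP F) (usetP G); first by move/ueq.
have [t Gt sep] := ultra_sep (usetP G) Gs.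
exists (V s, V t); first by rewrite !inE.
split; [exact: V_open|exact: V_open|].
apply/eqP/seteqP; split=> // H [Hs Ht].
have [z [Hz zs zt]] := filter_lb (ufilter H) Hs Ht.
by move: Hz; rewrite (sep z) //; exact: ultra_neq0 (usetP H).
Qed.

(* Given an ultrafilter Phi of subsets of the space, the t with V t in Phi form
   an ultrafilter of S, and Phi converges to it. *)
Lemma V_compact s : compact (V s).
Proof.
rewrite compact_ultra => Phi uPhi Phis.
have pPhi : ProperFilter Phi by exact: ultra_proper.
pose P := [set t | Phi (V t)].
have pP : is_proper_filter P.
  split; last by rewrite /P /= V0; exact: filter_not_empty.
  split; first by exists s.
    by move=> a t Pa at_; apply: filterS Pa; exact: V_sub.
  move=> x y Px Py; have [m hm] := has_meet x y; have [_ mx my _] := hm.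
  by exists m; split=> //; rewrite /P /= (V_meet hm); exact: filterI.
have uP : is_ultrafilter P.
  (* With [m] the meet of [s] and [t], and [e'] the complement of its domain, [s * e'] is the part
     of [s] disjoint from [t]. [Phi] contains [V s] but not [V m], as that lies inside [V t]; so it
     contains [V (s * e')]. *)
  apply: sep_ultra => // t Pt; have [m hm] := has_meet s t.
  have [_ ms mt mg] := hm.
  have [e' [he' ee' hc _]] := idem_compl (idemVg m).
  have Vs : V s `<=` V m `|` V (s * e').
    move=> F Fs; have [] := ultra_split (usetP F) Fs (idemVg m) he' hc.
      by have /leE <- := ms; left.
    by right.
  exists (s * e').
    have [Pm|Pm] := in_ultra_setVsetC (V m) uPhi.
      by exfalso; apply: Pt; apply: filterS Pm; exact: V_sub.
    apply: filterS (filterI Phis Pm) => F [/Vs[]//].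
  move=> u ut us; have um : u <= m.
    by apply: mg => //; apply: le_trans us _; exact: le_idemr.
  have hu := idemVg u; have ue := le_domV um; have ue' := dom_le_idem he' us.
  have [_ _ _ /(_ _ hu ue ue')] := idem_meet (idemVg m) he'.
  by rewrite ee' => /le0_eq /dom_eq0.
exists (Ultrafilter uP); split; first exact: Phis.
by move=> A /nbhs_uP[t Pt tA]; exact: filterS Pt.
Qed.

Lemma V_bisection s : @is_bisection ultrafilter_tg (V s).
Proof.
have inj F G : uset F s -> uset G s -> udom F = udom G -> F = G.
  move=> Fs Gs /(congr1 (@uset S)) /= FG; apply: ueq.
  rewrite -(filter_translate (ufilter F) Fs) -(filter_translate (ufilter G) Gs).
  by rewrite FG.
move=> F G Fs Gs; split; first exact: inj.
move=> FG; rewrite -(uinvK F) -(uinvK G); congr uinv.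
have inj' F' G' : uset F' s^-1 -> uset G' s^-1 -> udom F' = udom G' -> F' = G'.
  move=> Fs' Gs' /(congr1 (@uset S)) /= FG'; apply: ueq.
  rewrite -(filter_translate (ufilter F') Fs') -(filter_translate (ufilter G') Gs').
  by rewrite FG'.
by apply: inj'; rewrite // /uinv /= /finv /= im_invK.
Qed.

Lemma identities_V1 : identities ultrafilter_tg = V 1.
Proof.
apply/seteqP; split=> F; rewrite /identities /=.
  by move=> <-; exact: fdom1 (ufilter F).
by move=> F1; apply: ueq; apply: fdom_eq => //; exact: ufilter.
Qed.

Lemma ident_fdom F : identities ultrafilter_tg F -> fdom F = F.
Proof. by move=> /(congr1 (@uset S)). Qed.

(** On [V s] the domain map has the explicit inverse sending an identity [P] that contains
    [s^-1 * s] to its translate by [s]. *)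
Lemma u_etale : is_etale ultrafilter_tg.
Proof.
move=> F; have [[s Fs] _ _] := ufilter F.
pose W : set (set_type (identities ultrafilter_tg)) := [set P | uset (sval P) (s^-1 * s)].
exists (V s), W; split => //; first exact: V_open.
  by exists (V (s^-1 * s)); first exact: V_open.
have Wid (P : set_type (identities ultrafilter_tg)) : fdom (sval P : U) = sval P :> set S.
  by case: P => P /= /set_mem/ident_fdom.
(* The value [F] off [W] is a placeholder making [g] total; continuity and cancellation are asked
   within [W] only. *)
pose g (P : set_type (identities ultrafilter_tg)) : U :=
  if pselect (W P) is left WP
  then Ultrafilter (translate_ultra (usetP (sval P)) (Wid P) WP) else F.
have gE P : W P -> uset (g P) = translate s (uset (sval P) : set S).
  by move=> WP; rewrite /g; case: pselect.
split.
- split.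
  + by move=> G Gs; exact: mem_fdom.
  + move=> G H; rewrite !inE => Gs Hs GH; have [+ _] := V_bisection Gs Hs.
    by apply; have := congr1 sval GH.
  + move=> P WP; exists (g P).
      by rewrite /V /= gE //; apply: mem_translate => //; exact: ufilter.
    apply: val_inj; apply: ueq => /=; rewrite gE // fdom_translate //.
    exact: ufilter.
- apply: continuous_subspaceT => G A.
  rewrite nbhsE => -[B [[O oO <-] /= /oO[t [a Ga at_] tO]] BA].
  apply/nbhs_uP; exists a => // H Ha; apply: BA; apply: tO.
  by exists a.
- exists g.
    apply/subspace_continuousP => P WP A /nbhs_uP[t]; rewrite gE //.
    move=> -[p Pp spt] tA.
    apply: (@filterS _ (nbhs P) _ (sval @^-1` V p) (fun Q => W Q -> A (g Q))).
      move=> Q Qp WQ; by apply: (tA (g Q)); rewrite /V /= gE //; exists p.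
    by apply: open_nbhs_nbhs; split => //; exists (V p) => //; exact: V_open.
  move=> G; rewrite inE => Gs; apply: ueq; rewrite gE; last exact: mem_fdom.
  by apply: filter_translate => //; exact: ufilter.
Qed.

Lemma u_boolean : is_boolean_groupoid ultrafilter_tg.
Proof.
split; [exact: u_hausdorff|exact: u_etale| |].
  by rewrite identities_V1; exact: V_compact.
exists (range (@V S)) => [|_ [s _ <-]].
  split=> [_ [s _ <-]|F A /nbhs_uP[s Fs sA]]; first exact: V_open.
  by exists (V s) => //; split => //; exists s.
by split; [exact: V_compact|exact: V_open|exact: V_bisection].
Qed.

Definition ultrafilter_bg : booleanGroupoid := BooleanGroupoid u_boolean.

End UltrafilterSpace.

(** * Products of subsets of a groupoid *)

Section GroupoidTheory.
Variable G : topGroupoid.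
Implicit Types (a b c g h x y : G) (A B C : set G).

Definition inv : G -> G := ginv (tg_groupoid G).

Lemma dom_dom g : dom (dom g) = dom g. Proof. exact: gdom_dom. Qed.
Lemma cod_dom g : cod (dom g) = dom g. Proof. exact: gcod_dom. Qed.
Lemma dom_cod g : dom (cod g) = cod g. Proof. exact: gdom_cod. Qed.
Lemma dom_inv g : dom (inv g) = cod g. Proof. exact: gdom_inv. Qed.
Lemma cod_inv g : cod (inv g) = dom g. Proof. exact: gcod_inv. Qed.
Lemma mul_dom g : mul g (dom g) = g. Proof. exact: gmul_dom. Qed.
Lemma mul_cod g : mul (cod g) g = g. Proof. exact: gmul_cod. Qed.
Lemma mulVg_dom g : mul (inv g) g = dom g. Proof. exact: gmulVg. Qed.
Lemma mulgV_cod g : mul g (inv g) = cod g. Proof. exact: gmulgV. Qed.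
Lemma dom_mul g h : dom g = cod h -> dom (mul g h) = dom h.
Proof. exact: gdom_mul. Qed.
Lemma cod_mul g h : dom g = cod h -> cod (mul g h) = cod g.
Proof. exact: gcod_mul. Qed.
Lemma mul_assoc a b c : dom a = cod b -> dom b = cod c ->
  mul a (mul b c) = mul (mul a b) c.
Proof. exact: gmulA. Qed.

Lemma inv_inv g : inv (inv g) = g.
Proof.
have h : dom (inv (inv g)) = cod (inv g) by rewrite dom_inv.
rewrite -{1}(mul_dom (inv (inv g))) h cod_inv -mulVg_dom.
by rewrite mul_assoc ?dom_inv // mulVg_dom dom_inv mul_cod.
Qed.

Lemma mulKVg g h : cod g = cod h -> mul g (mul (inv g) h) = h.
Proof.
move=> gh; rewrite mul_assoc ?dom_inv ?cod_inv // mulgV_cod gh.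
exact: mul_cod.
Qed.

Lemma mulKg g h : dom g = cod h -> mul (inv g) (mul g h) = h.
Proof. by have := @mulKVg (inv g) h; rewrite inv_inv cod_inv. Qed.

Lemma cod_id e : identities G e -> cod e = e.
Proof. by move=> <-; exact: cod_dom. Qed.

Lemma mul_idr g e : identities G e -> dom g = cod e -> mul g e = g.
Proof. by move=> ie; rewrite cod_id // => <-; exact: mul_dom. Qed.

Lemma mul_idl g e : identities G e -> dom e = cod g -> mul e g = g.
Proof. by move=> -> ->; exact: mul_cod. Qed.

Definition smul A B : set G :=
  [set g | exists a b, [/\ A a, B b, dom a = cod b & g = mul a b]].

Definition sinv A : set G := [set g | A (inv g)].

Lemma mem_smul A B a b : A a -> B b -> dom a = cod b -> smul A B (mul a b).
Proof. by move=> Aa Bb ab; exists a, b. Qed.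

Lemma smulA A B C : smul A (smul B C) = smul (smul A B) C.
Proof.
apply/seteqP; split=> g.
  move=> [a [_ [Aa [b [c [Bb Cc bc ->]]] abc ->]]].
  have ab : dom a = cod b by rewrite abc cod_mul.
  by exists (mul a b), c; rewrite dom_mul // -mul_assoc //; split=> //; exact: mem_smul.
move=> [_ [c [[a [b [Aa Bb ab ->]]] Cc abc ->]]].
have bc : dom b = cod c by rewrite -abc dom_mul.
exists a, (mul b c); rewrite cod_mul // mul_assoc //; split=> //.
exact: mem_smul.
Qed.

Lemma smul1 A : smul A (identities G) = A.
Proof.
apply/seteqP; split=> g; first by move=> [a [b [Aa ib ab ->]]]; rewrite mul_idr.
move=> Ag; exists g, (dom g); rewrite mul_dom cod_dom; split=> //.
exact: dom_dom.
Qed.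

Lemma s1mul A : smul (identities G) A = A.
Proof.
apply/seteqP; split=> g; first by move=> [a [b [ia Ab ab ->]]]; rewrite mul_idl.
move=> Ag; exists (cod g), g; rewrite mul_cod dom_cod; split=> //.
exact: dom_cod.
Qed.

Lemma smul0 A : smul A set0 = set0.
Proof. by apply/seteqP; split=> // g [a [b []]]. Qed.

Lemma s0mul A : smul set0 A = set0.
Proof. by apply/seteqP; split=> // g [a [b []]]. Qed.

Lemma sinvK A : sinv (sinv A) = A.
Proof. by apply/funext => g; rewrite /sinv /= inv_inv. Qed.

Lemma bisection_sub A B : A `<=` B -> is_bisection B -> is_bisection A.
Proof. by move=> AB bB a b /AB Ba /AB Bb; exact: bB. Qed.

Lemma bisection_smul A B : is_bisection A -> is_bisection B ->
  is_bisection (smul A B).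
Proof.
move=> bA bB _ _ [a [b [Aa Bb ab ->]]] [a' [b' [Aa' Bb' ab' ->]]].
rewrite !dom_mul // !cod_mul //; split=> e.
  have bb : b = b' by apply: (bB _ _ Bb Bb').1.
  have aa : a = a' by apply: (bA _ _ Aa Aa').1; rewrite ab ab' bb.
  by rewrite aa bb.
have aa : a = a' by apply: (bA _ _ Aa Aa').2.
have bb : b = b' by apply: (bB _ _ Bb Bb').2; rewrite -ab -ab' aa.
by rewrite aa bb.
Qed.

Lemma bisection_sinv A : is_bisection A -> is_bisection (sinv A).
Proof.
move=> bA a b Aa Ab; have [] := bA _ _ Aa Ab.
rewrite !dom_inv !cod_inv => h1 h2.
by split=> e; rewrite -(inv_inv a) -(inv_inv b); congr inv; auto.
Qed.

Lemma smul_sub A A' B B' : A `<=` A' -> B `<=` B' -> smul A B `<=` smul A' B'.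
Proof.
by move=> sA sB _ [a [b [/sA Aa /sB Bb ab ->]]]; exact: mem_smul.
Qed.

Lemma smul_idr A E : E `<=` identities G -> smul A E `<=` A.
Proof. by move=> sE; rewrite -{2}(smul1 A); exact: smul_sub. Qed.

Lemma smul_idem E : E `<=` identities G -> smul E E = E.
Proof.
move=> sE; apply/seteqP; split; first exact: smul_idr.
by move=> e Ee; have ie := sE _ Ee; exists e, e; rewrite mul_idr // cod_id.
Qed.

(** Writing [a] as a product [mul b c] in [A], equal codomains force [b = a] and equal domains force
    [c = a]. So [a] is idempotent, and cancelling shows it is an identity. *)
Lemma idem_sub_id A : is_bisection A -> smul A A = A -> A `<=` identities G.
Proof.
move=> bA AA a Aa; have : smul A A a by rewrite AA.
move=> [b [c [Ab Ac bc e]]].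
have ba : a = b by apply: (bA _ _ Aa Ab).2; rewrite e cod_mul.
have ca : a = c by apply: (bA _ _ Aa Ac).1; rewrite e dom_mul.
subst b c; have := mulKg bc; rewrite -e mulVg_dom => h.
exact: h.
Qed.

Lemma smulVK A : is_bisection A -> smul (smul A (sinv A)) A = A.
Proof.
move=> bA; apply/seteqP; split=> g.
  move=> [_ [c [[a [b [Aa Ab ab ->]]] Ac abc ->]]].
  have bc : dom b = cod c by rewrite -abc dom_mul.
  have -> : c = inv b.
    by apply: (bA _ _ Ac Ab).2; rewrite cod_inv -abc dom_mul.
  rewrite -mul_assoc //; last by rewrite cod_inv.
  by rewrite mulgV_cod -ab mul_dom.
move=> Ag; exists (mul g (inv g)), g.
split=> //; last by rewrite mulgV_cod mul_cod.
  by apply: mem_smul => //; rewrite ?cod_inv // /sinv /= inv_inv.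
by rewrite mulgV_cod dom_cod.
Qed.

(** An inverse arrow [inv g] of [A] factors as [a b c]; the bisection property forces [a] and [c] to
    be [inv g], leaving [b = g]. Used with [A] and [B] exchanged as well, it gives uniqueness of
    inverses. *)
Lemma smul_inverse_sub A B : is_bisection A -> smul (smul A B) A = A ->
  sinv A `<=` B.
Proof.
move=> bA ABA g Ag; have : smul (smul A B) A (inv g) by rewrite ABA.
move=> [_ [c [[a [b [Aa Bb ab ->]]] Ac abc e]]].
have bc : dom b = cod c by rewrite -abc dom_mul.
have ea : inv g = a by apply: (bA _ _ Ag Aa).2; rewrite e !cod_mul.
have ec : inv g = c by apply: (bA _ _ Ag Ac).1; rewrite e dom_mul.
move: e; rewrite -mul_assoc // -ea => e.
have {}e : dom (inv g) = mul b c.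
  by rewrite -(mulKg (g := inv g) (h := mul b c)) -?e ?mulVg_dom // cod_mul // ea.
have : mul b (mul c (inv c)) = g.
  rewrite mul_assoc ?cod_inv // -e -ec inv_inv dom_inv.
  exact: mul_cod.
by rewrite mulgV_cod -bc mul_dom => <-.
Qed.

Lemma sub_smul_dom A B : is_bisection B -> A `<=` B ->
  A = smul B (smul (sinv A) A).
Proof.
move=> bB AB; apply/seteqP; split=> g.
  move=> Ag; exists g, (mul (inv g) g); rewrite mulVg_dom cod_dom mul_dom.
  split=> //; first exact: AB.
  rewrite -mulVg_dom; apply: mem_smul => //; last by rewrite dom_inv.
  by rewrite /sinv /= inv_inv.
move=> [b [_ [Bb [a [a' [Aa Aa' aa' ->]]] ba ->]]].
rewrite cod_mul // in ba.
have bai : b = inv a by apply: (bB _ _ Bb (AB _ Aa)).1; rewrite dom_inv.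
by rewrite bai mulKg.
Qed.

Lemma smul_sinv_id A : is_bisection A -> smul (sinv A) A `<=` identities G.
Proof.
move=> bA _ [a [b [Aa Ab ab ->]]].
have -> : b = inv a by apply: (bA _ _ Ab Aa).2; rewrite cod_inv.
by rewrite mulgV_cod; exact: dom_cod.
Qed.

End GroupoidTheory.

Lemma closed_equalizer (X Y : topologicalType) (f g : X -> Y) :
  hausdorff_space Y -> continuous f -> continuous g ->
  closed [set x | f x = g x].
Proof.
move=> hY cf cg x clx; apply: hY => A B fA gB.
have nA : nbhs x (f @^-1` A) := cf x A fA.
have nB : nbhs x (g @^-1` B) := cg x B gB.
have [y [fgy [Ay By]]] := clx _ (filterI nA nB).
by exists (f y); split=> //; rewrite fgy.
Qed.

(** * Compact open bisections *)

Section BooleanGroupoidTopology.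
Variable G : booleanGroupoid.
Implicit Types (a b c g h x y : G) (A B C : set G).

Lemma bg_hausdorff : hausdorff_space G. Proof. by case: (bgP G). Qed.

Lemma inv_continuous : continuous (@inv G).
Proof. exact: tg_inv_continuous. Qed.

Lemma dom_continuous : continuous (@dom G).
Proof.
have [_ et _ _] := bgP G => g.
have [U [W [oU Ug oW [_ cU _]]]] := et g.
have c1 : {for g, continuous (@dom_identities G)}.
  move: cU; rewrite continuous_open_subspace // => /(_ g); apply.
  by rewrite inE.
have c2 : {for (dom_identities g), continuous (@set_val G (identities G))}.
  exact: initial_continuous.
exact: (continuous_comp c1 c2).
Qed.

Lemma cod_continuous : continuous (@cod G).
Proof.
have -> : @cod G = @dom G \o @inv G by apply/funext => g /=; rewrite dom_inv.
move=> g; apply: continuous_comp; first exact: inv_continuous.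
exact: dom_continuous.
Qed.

Lemma basis_bisection g A : nbhs g A ->
  exists B, [/\ B g, B `<=` A, compact B, open B & is_bisection B].
Proof.
have [_ _ _ [B [_ bB] hB]] := bgP G => /bB[C [BC Cg] CA].
by exists C; have [] := hB _ BC.
Qed.

(** Around an identity [e] take a bisection neighbourhood [B]. By continuity of the domain map, any
    [g] near [e] has [g] and [dom g] both in [B]; they have the same domain, so they are equal. *)
Lemma open_identities : open (identities G).
Proof.
rewrite openE => e ie; have [B [Be _ _ oB bB]] := basis_bisection (filterT (F := nbhs e)).
have nB : nbhs e B by exact: open_nbhs_nbhs.
have nd : nbhs e (@dom G @^-1` B) by apply: dom_continuous; rewrite ie.
apply: filterS (filterI nB nd) => g [Bg Bdg].
by apply: (bB _ _ Bdg Bg).1; exact: dom_dom.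
Qed.

(** The local inverse [k] given by the étale condition pulls [A] back to a neighbourhood in the
    space of identities; since the identities are open in [G], it is a neighbourhood in [G] too. *)
Lemma dom_open_map A : open A -> open (@dom G @` A).
Proof.
move=> oA; rewrite openE => _ [g Ag <-].
have [_ et _ _] := bgP G.
have [U [W [oU Ug oW [[sW _ surj] _ [k ck kK]]]]] := et g.
have Wg : W (dom_identities g) by exact: sW.
have kg : k (dom_identities g) = g by apply: kK; rewrite inE.
have nW : nbhs (dom_identities g) W by exact: open_nbhs_nbhs.
have nk : nbhs (dom_identities g) [set Q | W Q -> A (k Q)].
  have kA : nbhs (k (dom_identities g)) A by rewrite kg; exact: open_nbhs_nbhs.
  by have /subspace_continuousP/(_ _ Wg A kA) := ck.
have : nbhs (dom_identities g) (W `&` [set Q | W Q -> A (k Q)]) by exact: filterI.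
rewrite nbhsE => -[_ [[O oO <-] /= Og] sO].
apply: (filterS (P := O `&` identities G)); last first.
  apply: open_nbhs_nbhs; split; last by split=> //; exact: dom_dom.
  by apply: openI => //; exact: open_identities.
move=> e [Oe ie].
have [WQ /(_ WQ)] := sO (exist _ e (mem_set ie)) Oe.
have [x Ux xe] := surj _ WQ; rewrite -xe kK ?inE // => Ax.
by exists x => //; have := congr1 sval xe.
Qed.

Lemma open_sinv A : open A -> open (sinv A).
Proof. by move=> oA; apply: open_comp => // g _; exact: inv_continuous. Qed.

Lemma cod_open_map A : open A -> open (@cod G @` A).
Proof.
move=> /open_sinv/dom_open_map; congr open; apply/seteqP; split=> _ [g Ag <-].
  by exists (inv g) => //; rewrite -dom_inv inv_inv.
by exists (inv g); rewrite ?dom_inv // /sinv /= inv_inv.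
Qed.

(* If x = ab then y |-> a'^-1 y is defined near x for a' near a, and lands in B. *)
Lemma open_smul A B : open A -> open B -> open (smul A B).
Proof.
move=> oA oB; rewrite openE => _ [a [b [Aa Bb ab ->]]]; set x := mul a b.
have ax : cod a = cod x by rewrite cod_mul.
have dx : dom (inv a) = cod x by rewrite dom_inv.
have nB : nbhs (mul (inv a) x) B by rewrite /x mulKg //; exact: open_nbhs_nbhs.
have /subspace_continuousP/(_ (inv a, x) dx B nB) := @tg_mul_continuous G.
move=> [[W Z] [/= Wa Zx] WZB].
have nN : nbhs a (A `&` @inv G @^-1` W).
  by apply: filterI; [exact: open_nbhs_nbhs|exact: inv_continuous].
move: nN; rewrite nbhsE => -[N [oN Na] sN].
have nc : nbhs x (@cod G @^-1` (@cod G @` N)).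
  apply: cod_continuous; apply: open_nbhs_nbhs; split; first exact: cod_open_map.
  by exists a.
apply: filterS (filterI Zx nc) => y [Zy [c Nc cy]].
have [Ac Wc] := sN _ Nc.
rewrite -(mulKVg cy); apply: mem_smul => //; last by rewrite cod_mul ?dom_inv // cod_inv.
by apply: (WZB (inv c, y)) => //=; rewrite -[gdom _ _]/(dom _) dom_inv.
Qed.

(** The product is the continuous image of the composable pairs in [A] times [B]. Composability is a
    closed condition, as the equalizer of two continuous maps into a Hausdorff space. *)
Lemma compact_smul A B : compact A -> compact B -> compact (smul A B).
Proof.
move=> cA cB.
pose C := [set p : G * G | dom p.1 = cod p.2].
have cC : closed C.
  apply: (@closed_equalizer _ _ (@dom G \o fst) (@cod G \o snd)).
  - exact: bg_hausdorff.
  - by move=> q; apply: continuous_comp; [exact: cvg_fst|exact: dom_continuous].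
  - by move=> q; apply: continuous_comp; [exact: cvg_snd|exact: cod_continuous].
have -> : smul A B = (fun p : G * G => mul p.1 p.2) @` (A `*` B `&` C).
  apply/seteqP; split=> [_ [a [b [Aa Bb ab ->]]]|_ [[a b] [[Aa Bb] ab] <-]].
    by exists (a, b).
  exact: mem_smul.
apply: continuous_compact; last by apply: compact_closedI => //; exact: compact_setX.
apply: (@continuous_subspaceW _ _ _ C) => [q []//|].
exact: tg_mul_continuous.
Qed.

Lemma compact_sinv A : compact A -> compact (sinv A).
Proof.
move=> cA; have -> : sinv A = @inv G @` A.
  apply/seteqP; split=> [g Ag|_ [g Ag <-]]; first by exists (inv g) => //; exact: inv_inv.
  by rewrite /sinv /= inv_inv.
apply: continuous_compact => //; apply: continuous_subspaceT.
exact: inv_continuous.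
Qed.

Lemma compact_identities : compact (identities G).
Proof. by case: (bgP G). Qed.

Lemma bisection_identities : is_bisection (identities G).
Proof. by move=> a b ia ib; rewrite ia ib !cod_id. Qed.

Definition cob_pred A := [/\ compact A, open A & is_bisection A].

Record cob := Cob { cset :> set G; cobP : cob_pred cset }.

HB.instance Definition _ := gen_eqMixin cob.
HB.instance Definition _ := gen_choiceMixin cob.

Implicit Types X Y Z E : cob.

Lemma cob_eq X Y : cset X = cset Y -> X = Y.
Proof.
by case: X Y => [X pX] [Y pY] /= XY; subst Y; congr Cob; exact: Prop_irrelevance.
Qed.

Lemma cobc X : compact X. Proof. by case: (cobP X). Qed.
Lemma cobo X : open X. Proof. by case: (cobP X). Qed.
Lemma cobb X : is_bisection X. Proof. by case: (cobP X). Qed.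
Lemma cobcl X : closed X.
Proof. by apply: compact_closed; [exact: bg_hausdorff|exact: cobc]. Qed.

Lemma cob_mul_subproof X Y : cob_pred (smul X Y).
Proof.
split; first by apply: compact_smul; exact: cobc.
  by apply: open_smul; exact: cobo.
by apply: bisection_smul; exact: cobb.
Qed.
Definition cob_mul X Y := Cob (cob_mul_subproof X Y).

Lemma cob_one_subproof : cob_pred (identities G).
Proof.
by split; [exact: compact_identities|exact: open_identities|exact: bisection_identities].
Qed.
Definition cob_one := Cob cob_one_subproof.

Lemma cob_zero_subproof : cob_pred (set0 : set G).
Proof. by split; [exact: compact0|exact: open0|]. Qed.
Definition cob_zero := Cob cob_zero_subproof.

Lemma cob_inv_subproof X : cob_pred (sinv X).
Proof.
split; first by apply: compact_sinv; exact: cobc.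
  by apply: open_sinv; exact: cobo.
by apply: bisection_sinv; exact: cobb.
Qed.
Definition cob_inv X := Cob (cob_inv_subproof X).

(** Compact sets are closed because [G] is Hausdorff, so compactness survives intersections here and
    differences below: the source of meets and of complements. *)
Lemma cob_cap_subproof X Y : cob_pred (X `&` Y).
Proof.
split; first by apply: compact_closedI; [exact: cobc|exact: cobcl].
  by apply: openI; exact: cobo.
by apply: bisection_sub (@cobb X); exact: subIsetl.
Qed.
Definition cob_cap X Y := Cob (cob_cap_subproof X Y).

Lemma cob_diff_subproof X Y : cob_pred (X `\` Y).
Proof.
rewrite setDE; split.
- by apply: compact_closedI; [exact: cobc|apply: open_closedC; exact: cobo].
- by apply: openI; [exact: cobo|apply: closed_openC; exact: cobcl].
- by apply: bisection_sub (@cobb X); exact: subIsetl.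
Qed.
Definition cob_diff X Y := Cob (cob_diff_subproof X Y).

Lemma cob_cup_pred X Y : is_bisection (X `|` Y) -> cob_pred (X `|` Y).
Proof.
by split=> //; [apply: compactU; exact: cobc|apply: openU; exact: cobo].
Qed.

Lemma cob_mulA : associative cob_mul.
Proof. by move=> X Y Z; apply: cob_eq => /=; exact: smulA. Qed.

Lemma cob_mul1 : right_id cob_one cob_mul.
Proof. by move=> X; apply: cob_eq; exact: smul1. Qed.

Lemma cob_1mul : left_id cob_one cob_mul.
Proof. by move=> X; apply: cob_eq; exact: s1mul. Qed.

HB.instance Definition _ := isMonoid.Build cob cob_mulA cob_1mul cob_mul1.

Lemma cob_invP X Y :
  (X * Y * X = X /\ Y * X * Y = Y) <-> Y = cob_inv X.
Proof.
split=> [[/(congr1 cset)/= h1 /(congr1 cset)/= h2]|->].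
  apply: cob_eq => /=; apply/seteqP; split.
    have := smul_inverse_sub (@cobb Y) h2 => h g Yg.
    by apply: h; rewrite /sinv /= inv_inv.
  exact: smul_inverse_sub (@cobb X) h1.
split; apply: cob_eq => /=; first exact: smulVK (@cobb X).
rewrite -{2}(sinvK X); apply: smulVK; apply: bisection_sinv; exact: cobb.
Qed.

Lemma cob_mul0 X : cob_zero * X = cob_zero.
Proof. by apply: cob_eq; exact: s0mul. Qed.

Lemma cob_mulr0 X : X * cob_zero = cob_zero.
Proof. by apply: cob_eq; exact: smul0. Qed.

Definition cob_im : inverseMonoid0 := InverseMonoid0 cob_invP cob_mul0 cob_mulr0.

Lemma cob_idemE X : idempotents cob_im X <-> X `<=` identities G.
Proof.
split=> [/(congr1 cset)/= XX|sX]; first exact: idem_sub_id (@cobb X) XX.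
by apply: cob_eq => /=; exact: smul_idem.
Qed.

Lemma cob_leE X Y : @nat_le cob_im X Y <-> X `<=` Y.
Proof.
split=> [[E /cob_idemE sE ->] /=|XY]; first exact: smul_idr.
exists (cob_mul (cob_inv X) X); last first.
  by apply: cob_eq; apply: sub_smul_dom => //; exact: cobb.
apply/cob_idemE; apply: smul_sinv_id; exact: cobb.
Qed.

Lemma cob_meet (D : set cob) X Y : D (cob_cap X Y) ->
  is_meet D (@nat_le cob_im) X Y (cob_cap X Y).
Proof.
move=> DXY; split=> // [||Z _ /cob_leE ZX /cob_leE ZY].
- by apply/cob_leE; exact: subIsetl.
- by apply/cob_leE; exact: subIsetr.
- by apply/cob_leE; rewrite subsetI.
Qed.

Lemma cob_join (D : set cob) X Y Z : D Z -> cset Z = X `|` Y ->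
  is_join D (@nat_le cob_im) X Y Z.
Proof.
move=> DZ ZE; split=> // [||T _ /cob_leE XT /cob_leE YT]; apply/cob_leE; rewrite ZE.
- exact: subsetUl.
- exact: subsetUr.
- by rewrite subUset.
Qed.

Lemma cob_cup_idem X Y : idempotents cob_im X -> idempotents cob_im Y ->
  exists2 Z : cob, idempotents cob_im Z & cset Z = X `|` Y.
Proof.
move=> /cob_idemE iX /cob_idemE iY.
have sXY : X `|` Y `<=` identities G by rewrite subUset.
exists (Cob (cob_cup_pred (bisection_sub sXY bisection_identities))) => //.
exact/cob_idemE.
Qed.

Lemma cob_cap_idem X Y : idempotents cob_im X ->
  idempotents cob_im (cob_cap X Y).
Proof. by move=> /cob_idemE iX; apply/cob_idemE => g [/iX]. Qed.

Lemma cob_meetE X Y Z : idempotents cob_im X ->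
  is_meet (idempotents cob_im) (@nat_le cob_im) X Y Z -> cset Z = X `&` Y.
Proof.
move=> iX /(is_meet_uniq (cob_meet (cob_cap_idem Y iX))) <-; exact: erefl.
Qed.

Lemma cob_joinE X Y Z : idempotents cob_im X -> idempotents cob_im Y ->
  is_join (idempotents cob_im) (@nat_le cob_im) X Y Z -> cset Z = X `|` Y.
Proof.
move=> iX iY; have [W iW WE] := cob_cup_idem iX iY.
by move=> /(is_join_uniq (cob_join iW WE)) <-.
Qed.

Lemma cob_bottomE X :
  is_bottom (idempotents cob_im) (@nat_le cob_im) X <-> cset X = set0.
Proof.
split=> [[_ /(_ cob_zero)]|X0].
  have i0 : idempotents cob_im cob_zero by exact/cob_idemE.
  by move=> /(_ i0)/cob_leE; rewrite subset0.
split; first by apply/cob_idemE; rewrite X0.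
by move=> Y _; apply/cob_leE; rewrite X0.
Qed.

Lemma cob_topE X :
  is_top (idempotents cob_im) (@nat_le cob_im) X <->
  cset X = identities G.
Proof.
split=> [[/cob_idemE iX /(_ cob_one)]|X1].
  have i1 : idempotents cob_im cob_one by exact/cob_idemE.
  by move=> /(_ i1)/cob_leE X1; apply/seteqP.
split; first by apply/cob_idemE; rewrite X1.
by move=> Y /cob_idemE iY; apply/cob_leE; rewrite X1.
Qed.

Lemma cob_boolean : is_boolean cob_im.
Proof.
have po := @le_partial_order cob_im.
have bot : is_bottom (idempotents cob_im) (@nat_le cob_im) cob_zero.
  by split=> [|X _]; [apply/cob_idemE|apply/cob_leE].
have top : is_top (idempotents cob_im) (@nat_le cob_im) cob_one.
  by split=> [|X /cob_idemE]; [exact/cob_idemE|move=> ?; exact/cob_leE].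
split.
- split.
  + split.
      split; first exact: po.
      by move=> X Y iX iY; exists (cob_cap X Y); apply: cob_meet; exact: cob_cap_idem.
    move=> X Y iX iY; have [Z iZ ZE] := cob_cup_idem iX iY.
    by exists Z; exact: cob_join.
  + by exists cob_zero.
  + by exists cob_one.
  + move=> X Y Z YZ XY XZ M iX iY iZ /(cob_joinE iY iZ) YZE.
    move=> /[dup] /(cob_meetE iX) XYE [iXY _ _ _].
    move=> /[dup] /(cob_meetE iX) XZE [iXZ _ _ _].
    move=> /[dup] /(cob_meetE iX) ME [iM _ _ _].
    by apply: cob_join => //; rewrite ME YZE XYE XZE setIUr.
  + move=> X iX; exists (cob_diff cob_one X).
      by apply/cob_idemE => g [].
    exists cob_zero, cob_one; split=> //.
      have -> : cob_zero = cob_cap X (cob_diff cob_one X).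
        by apply: cob_eq; rewrite /= setDE setICA setICr setI0.
      by apply: cob_meet; exact: cob_cap_idem.
    apply: cob_join; first by case: top.
    by rewrite /= setDUK //; exact/cob_idemE.
- split; first exact: po.
  by move=> X Y _ _; exists (cob_cap X Y); exact: cob_meet.
- move=> X Y [/(congr1 cset)/= XY /(congr1 cset)/= YX].
  (* Orthogonality read on arrows: an empty product of [sinv X] with [Y] excludes a common codomain,
     and an empty product of [X] with [sinv Y] excludes a common domain. *)
  have bXY : is_bisection (X `|` Y).
    have key1 x y : cset X x -> cset Y y -> dom x = dom y -> False.
      move=> Xx Yy xy; rewrite -[False]/(set0 (mul x (inv y))) -YX.
      by apply: mem_smul => //; rewrite ?cod_inv // /sinv /= inv_inv.
    have key2 x y : cset X x -> cset Y y -> cod x = cod y -> False.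
      move=> Xx Yy xy; rewrite -[False]/(set0 (mul (inv x) y)) -XY.
      by apply: mem_smul => //; rewrite ?dom_inv // /sinv /= inv_inv.
    move=> a b [Xa|Ya] [Xb|Yb]; [exact: (@cobb X)| | |exact: (@cobb Y)].
      by split=> ab; exfalso; [exact: key1 ab|exact: key2 ab].
    by split=> ab; exfalso; [exact: key1 (esym ab)|exact: key2 (esym ab)].
  by exists (Cob (cob_cup_pred bXY)); exact: cob_join.
Qed.

Definition cob_bim : booleanInverseMonoid := BooleanInverseMonoid cob_boolean.

End BooleanGroupoidTopology.

(** * Representation by bisections *)

Section MultiplicativeBijections.
Variables (S T : booleanInverseMonoid) (f : S -> T) (g : T -> S).
Hypotheses (fK : cancel f g) (gK : cancel g f) (fM : {morph f : x y / x * y}).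

Lemma bij_inj : injective f. Proof. exact: can_inj fK. Qed.

Lemma bij_idem x : idempotents T (f x) <-> idempotents S x.
Proof.
rewrite /idempotents /= -fM; split=> [|xx]; first exact: bij_inj.
by congr f.
Qed.

Lemma bij_idemV y : idempotents S (g y) <-> idempotents T y.
Proof. by rewrite -{2}(gK y) bij_idem. Qed.

Lemma bij_le x y : f x <= f y <-> x <= y.
Proof.
split=> [[e he xy]|[e he ->]].
  exists (g e); first exact/bij_idemV.
  by apply: bij_inj; rewrite fM gK.
by exists (f e); [exact/bij_idem|exact: fM].
Qed.

Lemma bij_0 : f 0 = 0.
Proof. by have := fM 0 (g 0); rewrite im_mul0 gK im_mulr0. Qed.

Section Transfer.
Variables (D : set S) (E : set T).
Hypothesis DE : forall x, E (f x) <-> D x.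

Let all_f (P : T -> Prop) : (forall x, D x -> P (f x)) -> forall y, E y -> P y.
Proof. by move=> h y; rewrite -(gK y) => /DE /h. Qed.

(** The pair of [D] and [E] is left general so that one argument serves both the idempotents and the
    whole monoids. *)
Lemma bij_meet x y m : is_meet D (@nat_le S) x y m ->
  is_meet E (@nat_le T) (f x) (f y) (f m).
Proof.
move=> [Dm mx my gm]; split; [exact/DE|exact/bij_le|exact/bij_le|].
by apply: all_f => z Dz /bij_le zx /bij_le zy; apply/bij_le; exact: gm.
Qed.

Lemma bij_join x y m : is_join D (@nat_le S) x y m ->
  is_join E (@nat_le T) (f x) (f y) (f m).
Proof.
move=> [Dm mx my gm]; split; [exact/DE|exact/bij_le|exact/bij_le|].
by apply: all_f => z Dz /bij_le zx /bij_le zy; apply/bij_le; exact: gm.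
Qed.

Lemma bij_bottom b : is_bottom D (@nat_le S) b -> is_bottom E (@nat_le T) (f b).
Proof.
move=> [Db hb]; split; first exact/DE.
by apply: all_f => z Dz; apply/bij_le; exact: hb.
Qed.

Lemma bij_top b : is_top D (@nat_le S) b -> is_top E (@nat_le T) (f b).
Proof.
move=> [Db hb]; split; first exact/DE.
by apply: all_f => z Dz; apply/bij_le; exact: hb.
Qed.

End Transfer.

Lemma bij_proper_filter (F : set T) : is_proper_filter F ->
  is_proper_filter (f @^-1` F).
Proof.
move=> [fF F0]; have [[t Ft] _ _] := fF; split; last by rewrite /= bij_0.
split; first by exists (g t); rewrite /= gK.
  by move=> a s Fa /bij_le; exact: filter_up.
move=> x y Fx Fy; have [z [Fz zx zy]] := filter_lb fF Fx Fy.
by exists (g z); split; rewrite /= ?gK // -bij_le gK.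
Qed.

End MultiplicativeBijections.

(** The order is defined from the multiplication, so every order-theoretic notion follows a
    multiplicative bijection. For (M3), a competing proper filter is carried back along [g], where
    maximality of [F] applies. *)
Lemma bijective_bim_morphism (S T : booleanInverseMonoid) (f : S -> T)
    (g : T -> S) : cancel f g -> cancel g f -> {morph f : x y / x * y} ->
  is_bim_morphism f.
Proof.
move=> fK gK fM.
have gM : {morph g : x y / x * y}.
  by move=> x y; apply: (can_inj fK); rewrite fM !gK.
have iE := bij_idem fK fM; split => //.
- split; first split.
  + by move=> x /iE.
  + by move=> x y m _ _; exact: bij_meet.
  + by move=> x y m _ _; exact: bij_join.
  + by move=> b; exact: bij_bottom.
  + by move=> b; exact: bij_top.
  + move=> x y _ _ [b [t [hb ht hm hj]]].
    exists (f b), (f t).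
    by split; [exact: bij_bottom|exact: bij_top|exact: bij_meet|exact: bij_join].
- by split=> // x y m _ _; exact: bij_meet.
- move=> F [pF mF]; split; first exact: bij_proper_filter.
  move=> F' pF' sF.
  have pg := bij_proper_filter gK fK gM pF'.
  have <- : g @^-1` F' = F.
    apply: mF => // y Fy; apply: sF; by rewrite /= gK.
  by apply/funext => x; rewrite /= fK.
Qed.

(** * The isomorphism of a boolean inverse monoid with the bisections of its groupoid *)

Section RepresentationByBisections.
Variable S : booleanInverseMonoid.
Local Notation U := (ultrafilter S).
Implicit Types (s t u x y e f : S) (F G H : U).

Lemma V_mul s t : V (s * t) = @smul (ultrafilter_tg S) (V s) (V t).
Proof.
apply/seteqP; split=> [F Fst|_ [F [G [Fs Gt FG ->]]]]; last first.
  by rewrite /V /= [uset _]umulE //; exists s, t; split=> //; exact: le_refl.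
(* An [F] through [s * t] is factored by choosing the right factor [H] to be the ultrafilter through
   [t] with the domain of [F]; the left factor is then the product of [F] with the inverse of
   [H]. *)
have Dt : uset (udom F) (t^-1 * t).
  exists (s * t) => //; rewrite im_invM mulgA -(mulgA t^-1); apply: le_mulr.
  by apply: le_idemr; exact: idemVg.
pose H := Ultrafilter (translate_ultra (usetP (udom F)) (fdom_fdom F) Dt).
have DH : udom H = udom F.
  by apply: ueq; apply: fdom_translate => //; [exact: ufilter (udom F)|exact: fdom_fdom].
have Ht : uset H t by apply: mem_translate => //; exact: ufilter (udom F).
have FHi : udom F = ucod (uinv H) by rewrite ucod_inv.
exists (umul F (uinv H)), H; split=> //.
- rewrite /V /= umulE //; exists (s * t), t^-1; split=> //.
    by rewrite /uinv /= /finv /= im_invK.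
  by rewrite -mulgA; apply: le_idemr; exact: idemgV.
- by rewrite -[dom _]/(udom _) udom_mul.
- by rewrite -[mul _ _]/(umul _ _) -umulA // umulVg DH umul_dom.
Qed.

(** Let [m] be the meet of [x] and [y], and [e'] the complement of its domain. An ultrafilter
    through [x * e'] would contain [x], hence [y], hence [m], which is disjoint from [x * e']. So
    [x * e' = 0], which forces [x = m]. *)
Lemma V_inj s t : V s = V t -> s = t.
Proof.
have key x y : V x `<=` V y -> x <= y.
  move=> xy; have [m hm] := has_meet x y; have [_ mx my _] := hm.
  have [e' [he' ee' _ hc]] := idem_compl (idemVg m).
  have xe0 : x * e' = 0.
    apply: contrapT => /exists_ultra[F uF Fxe].
    have Fx : F x by apply: (filter_up (ultra_filter uF) Fxe); exact: le_idemr.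
    have Fy : F y := xy (Ultrafilter uF) Fx.
    have [w [Fw wx wm]] := filter_lb (ultra_filter uF) Fxe
      (filter_meet (ultra_filter uF) hm Fx Fy).
    apply: (ultra_neq0 uF); rewrite (_ : 0 = w) //; apply/esym/dom_eq0/le0_eq.
    have [_ _ _] := idem_meet (idemVg m) he'; rewrite ee'; apply.
    + exact: idemVg.
    + exact: le_domV.
    + exact: dom_le_idem wx.
  have xm : x^-1 * x <= m^-1 * m.
    by apply: hc; [exact: idemVg|rewrite -mulgA xe0 im_mulr0].
  apply: le_trans my.
  have -> : x = x * (m^-1 * m); last by have /leE <- := mx; exact: le_refl.
  have /(idem_leE (idemVg x) (idemVg m)) h := xm.
  by rewrite -{1}(mulgVK x) -mulgA h (idem_comm (idemVg m) (idemVg x)) !mulgA mulgVK.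
move=> st; apply: le_anti; apply: key; rewrite st; exact: subset_refl.
Qed.

Lemma V_disjoint_join s t : V s `&` V t = set0 ->
  @is_bisection (ultrafilter_tg S) (V s `|` V t) -> exists j, V j = V s `|` V t.
Proof.
move=> st0 bst.
(* An ultrafilter through [a * b^-1] factors as [A B] with [A] through [a] and the inverse of [B]
   through [b]. These two have the same domain, so they coincide and lie in both [V a] and [V b]. *)
have key a b : @is_bisection (ultrafilter_tg S) (V a `|` V b) -> V a `&` V b = set0 ->
    a * b^-1 = 0.
  move=> bab ab0; apply: contrapT => /exists_ultra[F uF Fab].
  have : V (a * b^-1) (Ultrafilter uF) by [].
  rewrite V_mul => -[A [B [Aa Bb AB _]]].
  have AiB : A = uinv B.
    apply: (bab _ _ _ _).1; [by left|by right|].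
    by rewrite AB -[cod B]/(ucod B).
  have : (V a `&` V b) A by split=> //; rewrite AiB.
  by rewrite ab0.
have st : s * t^-1 = 0 by exact: key.
have st' : s^-1 * t = 0.
  have := key s^-1 t^-1; rewrite im_invK; apply.
    have -> : V s^-1 `|` V t^-1 = @sinv (ultrafilter_tg S) (V s `|` V t).
      apply/seteqP; split=> F.
        by move=> [Fs|Ft]; [left|right].
      by move=> [Fs|Ft]; [left|right].
    exact: bisection_sinv.
  apply/seteqP; split=> // F [Fs Ft].
  have : (V s `&` V t) (uinv F) by split.
  by rewrite st0.
have [_ _ ho] := bimP S; have [j [_ sj tj gj]] := ho _ _ (conj st' st).
exists j; apply/seteqP; split=> [F Fj|F [Fs|Ft]]; last 2 first.
- exact: V_sub Fs.
- exact: V_sub Ft.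
apply: contrapT => /not_orP[Fs Ft].
(* [e] and [f] are the complements of the domains of [s] and [t]. An [F] that contains [j] but
   neither [s] nor [t] must contain [j * e * f]. *)
have [e [he se0 hce hce']] := idem_compl (idemVg s).
have [f [hf tf0 hcf hcf']] := idem_compl (idemVg t).
have Fje : uset F (j * e).
  have [|//] := ultra_split (usetP F) Fj (idemVg s) he hce.
  by have /leE <- := sj.
have Fjef : uset F (j * e * f).
  have [h|//] := ultra_split (usetP F) Fje (idemVg t) hf hcf.
  exfalso; apply: Ft; apply: filter_up h _; first exact: ufilter.
  have /leE {3}-> := tj; apply: le_mulr; exact: le_idemr.
have hef := idem_mul he hf.
(* With [g] the complement of [e * f], both [s] and [t] lie below [j * g]; minimality of the join
   puts [j] below [j * g], so [j * e * f = 0]. *)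
have [g [hg efg0 hcg hcg']] := idem_compl hef.
have sg : s <= j * g.
  have /leE {1}-> := sj; apply: le_mull; apply: hcg; first exact: idemVg.
  by rewrite mulgA se0 im_mul0.
have tg : t <= j * g.
  have /leE {1}-> := tj; apply: le_mull; apply: hcg; first exact: idemVg.
  by rewrite (idem_comm he hf) mulgA tf0 im_mul0.
have /(dom_le_idem hg) jg := gj (j * g) I sg tg.
apply: (ultra_neq0 (usetP F)); rewrite (_ : 0 = j * e * f) //.
apply/esym/dom_eq0/le0_eq; rewrite -efg0.
have [_ _ _] := idem_meet hef hg; apply.
- exact: idemVg.
- by apply: (@dom_le_idem _ _ j) => //; rewrite mulgA; exact: le_refl.
- apply: le_trans jg; apply: le_domV.
  by rewrite -mulgA; exact: le_idemr.
Qed.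

(** Replacing [t] by [t * e], with [e] the complement of the domain of the meet, removes the overlap
    with [s] and leaves the union unchanged. *)
Lemma V_join s t : @is_bisection (ultrafilter_tg S) (V s `|` V t) ->
  exists j, V j = V s `|` V t.
Proof.
move=> bst; have [m hm] := has_meet s t; have [_ ms mt _] := hm.
have [e [he ee0 hc hc']] := idem_compl (idemVg m).
have eq : V s `|` V t = V s `|` V (t * e).
  apply/seteqP; split=> F [Fs|Ft]; [by left| |by left|].
    have [h|h] := ultra_split (usetP F) Ft (idemVg m) he hc; last by right.
    left; apply: V_sub ms _ _; have /leE -> := mt; exact: h.
  by right; apply: V_sub Ft; exact: le_idemr.
rewrite eq; apply: V_disjoint_join; last by rewrite -eq.
apply/seteqP; split=> // F [Fs Fte].
have Ft : uset F t by apply: V_sub Fte; exact: le_idemr.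
have Fm : uset F m by apply: filter_meet hm Fs Ft; exact: ufilter.
have [w [Fw wte wm]] := filter_lb (ufilter F) Fte Fm.
apply: (ultra_neq0 (usetP F)); rewrite (_ : 0 = w) //; apply/esym/dom_eq0/le0_eq.
have [_ _ _] := idem_meet (idemVg m) he; rewrite ee0; apply.
- exact: idemVg.
- exact: le_domV.
- exact: dom_le_idem wte.
Qed.

(** The finite subcover is phrased with a filter: joins make the sets [A] minus [V s], for [V s]
    inside [A], a filter base. If no [V s] is all of [A], it is proper and clusters at some [F] in
    [A], but a basic neighbourhood of [F] inside [A] is one of the sets removed. *)
Lemma V_surj (A : set U) : compact A -> open A -> @is_bisection (ultrafilter_tg S) A ->
  exists s, V s = A.
Proof.
move=> cA oA bA; apply: contrapT => nA.
pose D := [set s | V s `<=` A].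
pose Phi := filter_from D (fun s => A `\` V s).
have pPhi : ProperFilter Phi.
  apply: filter_from_proper.
    apply: filter_from_filter => [|s t sA tA].
      by exists 0; rewrite /D /= V0.
    have sub : V s `|` V t `<=` A by rewrite subUset.
    have [j jE] := V_join (@bisection_sub (ultrafilter_tg S) _ _ sub bA).
    by exists j; rewrite /D /= jE // setDUr.
  move=> s sA; apply: contrapT => h; apply: nA; exists s.
  apply/seteqP; split=> // F AF; apply: contrapT => Fs; apply: h.
  by exists F.
have PhiA : Phi A by exists 0; rewrite /D /= V0 // setD0.
have [F [AF clF]] := cA Phi pPhi PhiA.
have /uopenP/(_ _ AF)[s Fs sA] := oA.
have [||G [[_ nGs] Gs]] := clF (A `\` V s) (V s); last exact: nGs.
  by exists s.
exact: nbhs_V.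
Qed.

Lemma V_cob s : @cob_pred (ultrafilter_bg S) (V s).
Proof. by split; [exact: V_compact|exact: V_open|exact: V_bisection]. Qed.

Definition cob_V s : cob_bim (ultrafilter_bg S) := Cob (V_cob s).

Lemma cob_V_mul : {morph cob_V : s t / s * t}.
Proof. by move=> s t; apply: cob_eq; exact: V_mul. Qed.

Lemma cob_V_surj (X : cob (ultrafilter_bg S)) : exists s, cob_V s = X.
Proof.
have [s sX] := V_surj (@cobc _ X) (@cobo _ X) (@cobb _ X).
by exists s; exact: cob_eq.
Qed.

Definition V_inv (X : cob_bim (ultrafilter_bg S)) : S := projT1 (cid (cob_V_surj X)).

Lemma V_invK : cancel V_inv cob_V.
Proof. by move=> X; rewrite /V_inv; case: cid. Qed.

Lemma cob_VK : cancel cob_V V_inv.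
Proof.
by move=> s; apply: V_inj; have := V_invK (cob_V s) => /(congr1 (@cset _)).
Qed.

Lemma cob_V_morphism : is_bim_morphism cob_V.
Proof. exact: bijective_bim_morphism cob_VK V_invK cob_V_mul. Qed.

Lemma V_inv_morphism : is_bim_morphism V_inv.
Proof.
apply: bijective_bim_morphism V_invK cob_VK _ => X Y.
by apply: (can_inj cob_VK); rewrite cob_V_mul !V_invK.
Qed.

End RepresentationByBisections.

(** * The two functors on morphisms *)

Section UltrafilterFunctor.
Variables (S T : booleanInverseMonoid) (f : bim_hom S T).
Implicit Types (s t : S) (F : ultrafilter T).

Lemma bim_homM : {morph f : s t / s * t}.
Proof. exact: bim_mul (bim_homP f). Qed.

Lemma bim_hom_inv s : f s^-1 = (f s)^-1.
Proof. by apply: inv_uniq; rewrite -!bim_homM ?mulgVK ?mulVgK. Qed.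

Lemma bim_hom_le s t : s <= t -> f s <= f t.
Proof.
move=> [e he ->]; rewrite bim_homM; apply: le_idemr.
by rewrite /idempotents /= -bim_homM he.
Qed.

Definition ultra_map F : ultrafilter S :=
  Ultrafilter (bim_ultra (bim_homP f) (usetP F)).

Lemma ultra_map_dom F : ultra_map (udom F) = udom (ultra_map F).
Proof.
apply/esym/usub => x [s Fs sx]; exists (f s) => //.
by rewrite -bim_hom_inv -bim_homM; exact: bim_hom_le.
Qed.

Lemma ultra_map_inv F : ultra_map (uinv F) = uinv (ultra_map F).
Proof. by apply: ueq; apply/funext => x; rewrite /= /finv /= bim_hom_inv. Qed.

Lemma ultra_map_cod F : ultra_map (ucod F) = ucod (ultra_map F).
Proof. by rewrite /ucod ultra_map_dom ultra_map_inv. Qed.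

Lemma ultra_map_mul F G : udom F = ucod G ->
  ultra_map (umul F G) = umul (ultra_map F) (ultra_map G).
Proof.
move=> FG; apply/esym/usub => x.
rewrite umulE; last by rewrite -ultra_map_dom FG ultra_map_cod.
move=> [s [t [Fs Gt stx]]]; rewrite /= umulE //; exists (f s), (f t); split=> //.
by rewrite -bim_homM; exact: bim_hom_le.
Qed.

(** The star over [P] is lifted by translation: an ultrafilter [Q] through [s] over the image of [P]
    is hit by the translate of [P] by [f s]. Two ultrafilters with the same image share some [f s],
    since that image is nonempty by (M3). *)
Lemma ultra_map_covering :
  @is_covering_functor (ultrafilter_tg T) (ultrafilter_tg S) ultra_map.
Proof.
split.
- exact: ultra_map_dom.
- exact: ultra_map_cod.
- exact: ultra_map_mul.
- move=> P iP; split.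
  + by move=> F /= FP; rewrite -[dom _]/(udom _) -ultra_map_dom -FP.
  + move=> F G; rewrite !inE /= => FP GP FG.
    have [[s Fs] _ _] := ufilter (ultra_map F).
    have Gs : uset (ultra_map G) s by rewrite -FG.
    by apply: (@V_bisection _ (f s) F G Fs Gs).1; rewrite FP GP.
  + move=> Q /= QP; have [[s Qs] _ _] := ufilter Q.
    have Ps : uset P ((f s)^-1 * f s).
      have : uset (udom Q) (s^-1 * s) by exact: mem_fdom.
      by rewrite -[udom Q]/(@dom (ultrafilter_tg S) Q) QP /= bim_homM bim_hom_inv.
    have dP : fdom P = P by exact: ident_fdom.
    pose F := Ultrafilter (translate_ultra (usetP P) dP Ps).
    have FP : udom F = P.
      by apply: ueq; apply: fdom_translate => //; exact: ufilter.
    exists F => //.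
    have Fs : uset (ultra_map F) s by apply: mem_translate => //; exact: ufilter.
    apply: (@V_bisection _ s _ _ Fs Qs).1.
    by rewrite QP -[dom _]/(udom _) -ultra_map_dom FP.
Qed.

Lemma ultra_map_continuous : continuous ultra_map.
Proof. by apply: u_continuous => s; exact: V_open (f s). Qed.

Definition ultra_hom : bg_hom (ultrafilter_bg T) (ultrafilter_bg S) :=
  @BgHom (ultrafilter_bg T) (ultrafilter_bg S) _
    ultra_map_covering ultra_map_continuous.

End UltrafilterFunctor.

(** * Inverse images of compact open bisections *)

Lemma cluster_ultra_cvg (X Y : topologicalType) (f : X -> Y)
    (Phi : set_system X) (y : Y) :
  UltraFilter Phi -> cluster (f @ Phi) y -> f @ Phi --> y.
Proof.
move=> uPhi cly N Ny; have [//|h] := in_ultra_setVsetC (f @^-1` N) uPhi.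
by have [z [nNz Nz]] := cly (~` N) N h Ny.
Qed.

Section PreimageFunctor.
Variables (G H : booleanGroupoid) (f : bg_hom G H).
Implicit Types (g h : G) (A B : set H).

Let fcont : continuous f. Proof. exact: bg_continuous. Qed.
Let fdomE g : f (dom g) = dom (f g). Proof. exact: cf_dom (bg_covering f) g. Qed.
Let fcodE g : f (cod g) = cod (f g). Proof. exact: cf_cod (bg_covering f) g. Qed.
Let fmulE g h : dom g = cod h -> f (mul g h) = mul (f g) (f h).
Proof. exact: cf_mul (bg_covering f) g h. Qed.

Lemma covering_inj g h : dom g = dom h -> f g = f h -> g = h.
Proof.
move=> gh fgh; have [_ inj _] := cf_star (bg_covering f) (dom_dom g).
by apply: inj => //; rewrite inE /= ?gh.
Qed.

Lemma covering_lift g b : dom b = f (dom g) -> exists2 h, dom h = dom g & f h = b.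
Proof. by move=> bg; have [_ _ /(_ b bg)] := cf_star (bg_covering f) (dom_dom g). Qed.

Lemma covering_inv g : f (inv g) = inv (f g).
Proof.
rewrite -[RHS]mul_dom dom_inv -fcodE -mulgV_cod fmulE ?cod_inv //.
by rewrite mulKg // -fcodE cod_inv fdomE.
Qed.

Lemma covering_identities : f @^-1` identities H = identities G.
Proof.
apply/seteqP; split=> g; rewrite /identities /= => h; last by rewrite -fdomE h.
by apply: covering_inj; rewrite ?dom_dom // fdomE.
Qed.

Lemma preimage_bisection A : is_bisection A -> is_bisection (f @^-1` A).
Proof.
move=> bA a b Aa Ab; have [bd bc] := bA _ _ Aa Ab; split=> ab.
  by apply: covering_inj => //; apply: bd; rewrite -!fdomE ab.
(* The covering condition compares only arrows with a common domain, so the case of a common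
   codomain is passed to inverses. *)
have fab : f a = f b by apply: bc; rewrite -!fcodE ab.
rewrite -(inv_inv a) -(inv_inv b); congr inv; apply: covering_inj.
  by rewrite !dom_inv.
by rewrite !covering_inv fab.
Qed.

(* An ultrafilter Phi on the preimage of A has its image under f converging to
   some a in A and its image under dom converging to some e; it then converges
   to the lift of a at e. *)
Lemma preimage_compact A : compact A -> is_bisection A -> open A ->
  compact (f @^-1` A).
Proof.
move=> cA bA oA; rewrite compact_ultra => Phi uPhi PhiA.
have pPhi : ProperFilter Phi by exact: ultra_proper.
have [a [Aa /(cluster_ultra_cvg uPhi) fa]] := cA (f @ Phi) _ PhiA.
have Phid : (@dom G @ Phi) (identities G).
  by apply: (@filterS _ Phi _ (f @^-1` A) (@dom G @^-1` identities G)) => // x _; exact: dom_dom.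
have [e [ie /(cluster_ultra_cvg uPhi) de]] := @compact_identities G _ _ Phid.
have fe : dom a = f (dom e).
  rewrite ie; apply: (@bg_hausdorff H) => N M Na Me.
  have PN : Phi [set x | N (dom (f x))] := fa _ (@dom_continuous H a N Na).
  have PM : Phi [set x | M (f (dom x))] := de _ (@fcont e M Me).
  have [x [Nx Mx]] := filter_ex (filterI PN PM).
  by exists (dom (f x)); split=> //; rewrite -fdomE.
have [g ge fg] := covering_lift fe.
exists g; split; first by rewrite /= fg.
move=> N; rewrite nbhsE => -[O [oO Og] ON].
have oN : open (O `&` f @^-1` A).
  by apply: openI => //; apply: open_comp => // x _; exact: fcont.
have nd : nbhs e (@dom G @` (O `&` f @^-1` A)).
  apply: open_nbhs_nbhs; split; first exact: dom_open_map.
  by exists g; [split=> //=; rewrite fg|rewrite ge].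
have Pd : Phi [set x | (@dom G @` (O `&` f @^-1` A)) (dom x)] := de _ nd.
apply: filterS (filterI PhiA Pd) => x [Ax [y [Oy Ay] yx]].
by apply: ON; rewrite -((preimage_bisection bA Ay Ax).1 yx).
Qed.

Lemma preimage_cob (X : cob H) : cob_pred (f @^-1` X).
Proof.
split; first by apply: preimage_compact; [exact: cobc|exact: cobb|exact: cobo].
  by apply: open_comp; [move=> g _; exact: fcont|exact: cobo].
by apply: preimage_bisection; exact: cobb.
Qed.

Definition cob_preimage (X : cob_bim H) : cob_bim G := Cob (preimage_cob X).

(** If [f g] is the product of [a] and [b], lift [b] to an arrow [h] with the domain of [g]; then
    [g] is the product of [mul g (inv h)], which lies over [a], and [h]. *)
Lemma preimage_smul A B : f @^-1` (smul A B) = smul (f @^-1` A) (f @^-1` B).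
Proof.
apply/seteqP; split=> [g|_ [g [h [Ag Bh gh ->]]]]; last first.
  by rewrite /= fmulE //; apply: mem_smul => //; rewrite -fdomE gh fcodE.
move=> /= [a [b [Aa Bb ab fg]]].
have [|h hg fh] := @covering_lift g b.
  by rewrite fdomE fg dom_mul.
have gh : dom g = cod (inv h) by rewrite cod_inv hg.
exists (mul g (inv h)), h; split.
- rewrite /= fmulE // covering_inv fh fg -mul_assoc ?cod_inv //.
  by rewrite mulgV_cod -ab mul_dom.
- by rewrite /= fh.
- by rewrite dom_mul // dom_inv.
- by rewrite -mul_assoc // ?dom_inv // mulVg_dom hg mul_dom.
Qed.

Lemma cob_preimage_idem X : idempotents (cob_bim H) X ->
  idempotents (cob_bim G) (cob_preimage X).
Proof.
by move=> /cob_idemE iX; apply/cob_idemE; rewrite -covering_identities => g /iX.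
Qed.

End PreimageFunctor.

(** * Points of a boolean groupoid as ultrafilters *)

Section Points.
Variable G : booleanGroupoid.
Implicit Types (g h : G) (X Y : cob G).

Definition point_set g : set (cob_bim G) := [set X | cset X g].

Lemma basis_cob g (A : set G) : nbhs g A -> exists2 X : cob G, cset X g & X `<=` A.
Proof.
by move=> /basis_bisection[B [Bg BA cB oB bB]]; exists (Cob (And3 cB oB bB)).
Qed.

(** A compact open bisection that misses [g] is closed, so the basis gives one through [g] disjoint
    from it: exactly the separation criterion. *)
Lemma point_ultra g : is_ultrafilter (point_set g).
Proof.
apply: sep_ultra.
  split; last by [].
  split.
  - by have [X Xg _] := basis_cob (filterT (F := nbhs g)); exists X.
  - by move=> X Y Xg /cob_leE; exact.
  - move=> X Y Xg Yg; exists (cob_cap X Y).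
    by split=> //; apply/cob_leE; [exact: subIsetl|exact: subIsetr].
move=> X nX; have [Y Yg YX] : exists2 Y : cob G, cset Y g & Y `<=` ~` X.
  apply: basis_cob; apply: open_nbhs_nbhs; split=> //.
  by apply: closed_openC; exact: cobcl.
exists Y => // Z /cob_leE ZX /cob_leE ZY; apply: cob_eq; apply/seteqP.
by split=> // h Zh; case: (YX _ (ZY _ Zh)); exact: ZX.
Qed.

Definition point g : ultrafilter (cob_bim G) := Ultrafilter (point_ultra g).

Lemma point_inj g h : point g = point h -> g = h.
Proof.
move=> gh; apply: (@bg_hausdorff G) => A B Ag Bh.
have [X Xg XA] := basis_cob Ag; have [Y Yh YB] := basis_cob Bh.
exists h; split; last exact: YB.
have gX : uset (point g) X by [].
by apply: XA; rewrite gh in gX.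
Qed.

Lemma point_surj (F : ultrafilter (cob_bim G)) : exists g, point g = F.
Proof.
have fF := ufilter F; have [[X FX] _ _] := fF.
pose Phi := filter_from (uset F) (fun X : cob_bim G => cset X).
have pPhi : ProperFilter Phi.
  apply: filter_from_proper.
    apply: filter_from_filter; first by exists X.
    move=> Y Z FY FZ; have [W [FW /cob_leE WY /cob_leE WZ]] := filter_lb fF FY FZ.
    by exists W => //; rewrite subsetI.
  move=> Y FY; apply: contrapT => Y0; apply: (ultra_neq0 (usetP F)).
  rewrite (_ : 0 = Y) //; apply: cob_eq; apply/seteqP; split=> // g Yg.
  by exfalso; apply: Y0; exists g.
have [|g [Xg clg]] := @cobc _ X Phi pPhi; first by exists X.
(* The cluster point lies in every [Y] of [F] because each is closed; this inclusion of [F] in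
   [point g] suffices between ultrafilters. *)
exists g; apply/esym/usub => Y FY; rewrite /= /point_set /=.
apply: (@cobcl _ Y) => N Ng.
by have [|h [Yh Nh]] := clg Y N _ Ng; [exists Y|exists h].
Qed.

Lemma point_dom g : point (dom g) = udom (point g).
Proof.
apply/esym/usub => X [Y Yg /cob_leE]; apply; rewrite -mulVg_dom.
by apply: (@mem_smul _ (sinv (cset Y)) (cset Y)); rewrite ?dom_inv // /sinv /= inv_inv.
Qed.

Lemma point_inv g : point (inv g) = uinv (point g).
Proof. by apply: ueq. Qed.

Lemma point_cod g : point (cod g) = ucod (point g).
Proof. by rewrite -dom_inv point_dom point_inv. Qed.

Lemma point_mul g h : dom g = cod h ->
  point (mul g h) = umul (point g) (point h).
Proof.
move=> gh; apply/esym/usub => X; rewrite umulE; last first.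
  by rewrite -point_dom gh point_cod.
by move=> [Y [Z [Yg Zh /cob_leE]]]; apply; exact: mem_smul.
Qed.

Lemma point_continuous : continuous point.
Proof. by apply: u_continuous => X; exact: cobo. Qed.

Definition unpoint (F : ultrafilter (cob_bim G)) : G := projT1 (cid (point_surj F)).

Lemma unpointK : cancel unpoint point.
Proof. by move=> F; rewrite /unpoint; case: cid. Qed.

Lemma pointK : cancel point unpoint.
Proof. by move=> g; apply: point_inj; rewrite unpointK. Qed.

Lemma unpoint_continuous : continuous unpoint.
Proof.
move=> F A nA; have [X XF XA] := basis_cob nA.
have FX : uset F X by rewrite -(unpointK F).
apply: (@filterS _ (nbhs F) _ (V (X : cob_bim G)) (unpoint @^-1` A)); last exact: nbhs_V.
by move=> H HX; apply: XA; rewrite -[cset X _]/(uset (point (unpoint H)) X) unpointK.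
Qed.

End Points.

Lemma bijective_covering (G H : topGroupoid) (f : G -> H) (k : H -> G) :
  cancel f k -> cancel k f -> {morph f : g / dom g} -> {morph f : g / cod g} ->
  (forall g h, dom g = cod h -> f (mul g h) = mul (f g) (f h)) ->
  is_covering_functor f /\ is_covering_functor k.
Proof.
move=> fK kK fd fc fm.
have kd : {morph k : g / dom g} by move=> g; apply: (can_inj fK); rewrite fd !kK.
have kc : {morph k : g / cod g} by move=> g; apply: (can_inj fK); rewrite fc !kK.
split; split => //.
- move=> e _; split=> [g /= <-|g h _ _|h /= he]; [by rewrite fd|exact: can_inj|].
  by exists (k h) => //=; apply: (can_inj fK); rewrite fd kK.
- move=> g h gh; apply: (can_inj fK); rewrite fm ?kK //.
  by rewrite -kd gh kc.
- move=> e _; split=> [g /= <-|g h _ _|h /= he]; [by rewrite kd|exact: can_inj|].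
  by exists (f h) => //=; apply: (can_inj kK); rewrite kd fK.
Qed.

(** * The equivalence *)

Lemma cob_preimage_morphism (G H : booleanGroupoid) (f : bg_hom G H) :
  is_bim_morphism (cob_preimage f).
Proof.
split.
- by move=> X Y; apply: cob_eq; exact: preimage_smul.
- have idem := @cob_preimage_idem _ _ f.
  have hmeet X Y M : idempotents (cob_bim H) X ->
      is_meet (idempotents (cob_bim H)) (@nat_le _) X Y M ->
      is_meet (idempotents (cob_bim G)) (@nat_le _)
        (cob_preimage f X) (cob_preimage f Y) (cob_preimage f M).
    move=> iX /(cob_meetE iX) ME.
    have -> : cob_preimage f M = cob_cap (cob_preimage f X) (cob_preimage f Y).
      by apply: cob_eq; rewrite /= ME.
    by apply: cob_meet; apply: cob_cap_idem; exact: idem.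
  have hjoin X Y J : idempotents (cob_bim H) X -> idempotents (cob_bim H) Y ->
      is_join (idempotents (cob_bim H)) (@nat_le _) X Y J ->
      is_join (idempotents (cob_bim G)) (@nat_le _)
        (cob_preimage f X) (cob_preimage f Y) (cob_preimage f J).
    move=> iX iY /[dup] -[iJ _ _ _] /(cob_joinE iX iY) JE.
    by apply: cob_join; [exact: idem|rewrite /= JE].
  have hbot X : is_bottom (idempotents (cob_bim H)) (@nat_le _) X ->
      is_bottom (idempotents (cob_bim G)) (@nat_le _) (cob_preimage f X).
    by move=> /cob_bottomE X0; apply/cob_bottomE; rewrite /= X0.
  have htop X : is_top (idempotents (cob_bim H)) (@nat_le _) X ->
      is_top (idempotents (cob_bim G)) (@nat_le _) (cob_preimage f X).
    by move=> /cob_topE X1; apply/cob_topE; rewrite /= X1 covering_identities.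
  split; [by split=> // X Y M iX _; exact: hmeet| | | |] => //.
  move=> X Y iX iY [b [t [hb ht hm hj]]].
  exists (cob_preimage f b), (cob_preimage f t).
  by split; [exact: hbot|exact: htop|exact: hmeet|exact: hjoin].
- split=> // X Y M _ _ /(is_meet_uniq (cob_meet (D := setT) I)) <-.
  rewrite (_ : cob_preimage f (cob_cap X Y) = cob_cap (cob_preimage f X) (cob_preimage f Y)).
    exact: (cob_meet (D := setT) I).
  exact: cob_eq.
(* Every ultrafilter is a [point g], whose inverse image is by computation the point set of
   [f g]. *)
- move=> F uF; have [g gF] := point_surj (Ultrafilter uF).
  have -> : F = point_set g by rewrite -[F]/(uset (Ultrafilter uF)) -gF.
  exact: (point_ultra (f g)).
Qed.

Definition cob_hom (G H : booleanGroupoid) (f : bg_hom G H) :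
  bim_hom (cob_bim H) (cob_bim G) := BimHom (cob_preimage_morphism f).

(** Kept transparent, like [cob_functor], because the natural isomorphisms are typed and checked by
    computing the actions of both functors. *)
Definition ultra_functor : functor (opposite BIM) BG.
Proof.
refine (@Functor (opposite BIM) BG ultrafilter_bg
  (fun S T (f : bim_hom T S) => ultra_hom f) _ _).
- by move=> S; apply: bg_hom_eq => F; exact: ueq.
- by move=> S T U g f; apply: bg_hom_eq => F; exact: ueq.
Defined.

Definition cob_functor : functor BG (opposite BIM).
Proof.
refine (@Functor BG (opposite BIM) cob_bim
  (fun G H (f : bg_hom G H) => cob_hom f) _ _).
- by move=> G; apply: bim_hom_eq => X; exact: cob_eq.
- by move=> G H K g f; apply: bim_hom_eq => X; exact: cob_eq.
Defined.

Lemma naturally_isomorphic_sym (C D : category) (F G : functor C D) :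
  naturally_isomorphic F G -> naturally_isomorphic G F.
Proof.
move=> [eta [nat iso]].
exists (fun a => projT1 (cid (iso a))); split=> [a b f|a]; last first.
  by case: cid => g [] /= ge eg; exists (eta a).
case: (cid (iso a)) => g [] /= ge eg; case: (cid (iso b)) => h [] /= he eh.
rewrite -[LHS]compm_id -eg compmA -(compmA _ _ (eta a)) -nat.
by rewrite !compmA he compid_m.
Qed.

Theorem mainTheorem1 : equivalent_categories (opposite BIM) BG.
Proof.
exists ultra_functor, cob_functor; split.
  (* In the opposite category an arrow from the composite to [S] is a morphism out of [S], so
     [cob_V] already points the required way. *)
  exists (fun S : booleanInverseMonoid => BimHom (cob_V_morphism S)); split.
    move=> S T f; apply: bim_hom_eq => s; exact: cob_eq.
  move=> S; exists (BimHom (V_inv_morphism S)); split; apply: bim_hom_eq => x.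
    exact: V_invK.
  exact: cob_VK.
(* On the groupoid side [point] goes from the identity functor to the composite, opposite to what is
   asked. *)
apply: naturally_isomorphic_sym.
have cov (G : booleanGroupoid) := bijective_covering (G := G)
  (H := ultrafilter_tg (cob_bim G)) (@pointK G) (@unpointK G) (@point_dom G)
  (@point_cod G) (@point_mul G).
exists (fun G => @BgHom G (ultrafilter_bg (cob_bim G)) _ (cov G).1
  (@point_continuous G)); split.
  by move=> G H f; apply: bg_hom_eq => g; exact: ueq.
move=> G; exists (@BgHom (ultrafilter_bg (cob_bim G)) G _ (cov G).2
  (@unpoint_continuous G)); split; apply: bg_hom_eq => x.
  exact: pointK.
exact: unpointK.
Qed.
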